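(* Let $s$ and $k_1, \dots, k_s$ be fixed positive integers, and let $A_1, \dots, A_s$ be independent random sets in $\mathcal{B}(n_1, \alpha_1), \dots, \mathcal{B}(n_s, \alpha_s)$, respectively. If, for $i = 1, \dots, s$, we have $\alpha_i n_i \to +\infty$ and $$\alpha_i = o\!\left(\left((\log n_1)^{k_1 - 1}\prod_{j = 2}^s (\log n_j)^{k_j}\right)^{-(k_1 + \cdots + k_s - 1)/2}\right),$$ then $$|A_1^{k_1} \cdots A_s^{k_s}| \sim \frac{|A_1|^{k_1}}{k_1!}\cdots\frac{|A_s|^{k_s}}{k_s!}$$ with probability $1 - o(1)$.
   Context: For sets of positive integers $A$ and $B$, the product set is $AB := \{ab : a \in A,\, b \in B\}$, and $A^k := A \cdots A$ ($k$ times $A$) for any positive integer $k$. Thus $A_1^{k_1}\cdots A_s^{k_s}$ is the set of all products of $k_1$ (not necessarily distinct) elements of $A_1$, $k_2$ elements of $A_2$, ..., $k_s$ elements of $A_s$. For a positive integer $n$ and $\alpha \in [0,1]$, $\mathcal{B}(n, \alpha)$ denotes the probabilistic model in which a random set $A \subseteq \{1, \dots, n\}$ is constructed by choosing independently every element of $\{1, \dots, n\}$ with probability $\alpha$. The parameters $n_i$ (positive integers) and $\alpha_i \in [0,1]$ vary (e.g. along a sequence indexed by $N \to \infty$), while $s, k_1, \dots, k_s$ are fixed; all limits and $o(\cdot)$ symbols refer to this variation. An $o_\varepsilon(1)$ quantity tends to $0$ for each fixed $\varepsilon$. For real random variables $X$ and $Y$, ''$X = o(Y)$ with probability $1 - o(1)$''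 means that $\mathbb{P}(|X| \geq \varepsilon|Y|) = o_\varepsilon(1)$ for every $\varepsilon > 0$; and ''$X \sim Y$ with probability $1 - o(1)$'' means that $X = Y + o(Y)$ with probability $1 - o(1)$. *)

(* Defs.v *)
From HB Require Import structures.
From mathcomp Require Export all_boot all_order all_algebra finmap.
From mathcomp Require Export all_classical all_reals all_analysis.

Set Implicit Arguments.
Unset Strict Implicit.
Unset Printing Implicit Defensive.

Export Order.TTheory GRing.Theory Num.Theory.
Export numFieldNormedType.Exports.

Local Open Scope classical_set_scope.
Local Open Scope ring_scope.

Definition prodset (A B : {fset nat}) : {fset nat} :=
  [fset (a * b)%N | a in A, b in B]%fset.

Definition powset (A : {fset nat}) (k : nat) : {fset nat} :=
  iter k (prodset A) [fset 1%N]%fset.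

Definition prodpowset (s : nat) (A : 'I_s -> {fset nat}) (k : 'I_s -> nat) :
  {fset nat} := \big[prodset/[fset 1%N]%fset]_(i < s) powset (A i) (k i).

Section RandomSets.
Context {R : realType} {d : measure_display} {T : measurableType d}.
Variable P : probability T R.

Definition independent_events (I : choiceType) (D : set I) (E : I -> set T) :=
  forall J : {fset I}, [set` J] `<=` D ->
    (P (\bigcap_(j in [set` J]) E j) = \prod_(j <- J) P (E j))%E.

Definition binomial_random_set (n : nat) (alpha : R) (A : T -> {fset nat}) :=
  [/\ forall w m, m \in A w -> (1 <= m <= n)%N,
      forall m, measurable [set w | m \in A w],
      forall m, (1 <= m <= n)%N -> P [set w | m \in A w] = alpha%:E &
      independent_events [set m | (1 <= m <= n)%N]
        (fun m => [set w | m \in A w])].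

(* The countable type {fset nat} carries the discrete sigma-algebra, hence [S i]
   is arbitrary; subfamilies are covered by taking some of the [S i] full. *)
Definition independent_random_sets (s : nat) (A : 'I_s -> T -> {fset nat}) :=
  forall S : 'I_s -> set {fset nat},
    (P (\bigcap_(i in [set: 'I_s]) (A i @^-1` S i))
     = \prod_(i < s) P (A i @^-1` S i))%E.

End RandomSets.

Section WithHighProbability.
Context {R : realType} {d : nat -> measure_display}
  {T : forall N, measurableType (d N)}.
Variable P : forall N, probability (T N) R.

Definition whp_littleo (X Y : forall N, T N -> R) :=
  forall eps : R, 0 < eps ->
    P N [set w | `|X N w| >= eps * `|Y N w|] @[N --> \oo] --> 0%E.

Definition whp_equiv (X Y : forall N, T N -> R) :=
  whp_littleo (fun N w => X N w - Y N w) Y.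

End WithHighProbability.

(* Main.v *)
Require Import Defs.
From mathcomp Require Import zify ring lra measurable_realfun.

(** Why the theorem is true.  Write [Y] for the product of the
    [|A_i| ^ k_i / k_i!], and call a position a pair [(i, j)] with [j < k_i], so
    that there are [K = k_1 + ... + k_s] positions.

    Every element of the product set is the product of a family of multisets,
    the [i]-th one consisting of [k_i] elements of [A_i]; counting these families
    gives the upper bound [prod_i C(|A_i| + k_i - 1, k_i)] (card_prodpowset),
    which is [(1 + o(1)) Y] as soon as every [|A_i|] tends to infinity.

    For the lower bound, let [S_i] range over the [k_i]-subsets of [A_i].  There
    are [prod_i C(|A_i|, k_i) = (1 - o(1)) Y] such families, and distinct families
    can only be lost to a collision, that is, to two distinct families with the
    same product.  Enumerating both families with their common elements first
    turns a collision into a set [T] of positions and two tuples [x], [y] that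
    agree off [T], have the same product over [T], and use no value of [y] on [T]
    in [x]; moreover [|T| >= 2], since a single position would force [x = y].  So
    the product set has at least [prod_i C(|A_i|, k_i) - Z] elements, where [Z]
    counts these configurations inside the random sets (prod_bin_le_card).

    The separation of [x] and [y] makes the membership events independent: a
    configuration is captured with probability
    [prod_p alpha_p * prod_(p in T) alpha_p] (prob_captured).  It remains to count
    configurations.  If [prod_T x = prod_T y], there is a matrix [e] indexed by
    [T * T] with row products [x] and column products [y] (exists_factor_matrix).
    Only the row constraints [prod_q e p q <= n_p] and the size constraints
    [e p q <= n_q] are kept: summing out the entry at a fixed position [o], row
    [p] has at most [n_p * H] possibilities, where [H] is the product of the
    harmonic numbers of [n_q] over the positions [q != o].  Hence there are at
    most [prod_p n_p * H ^ |T|] configurations with a given [T], and their expected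
    number is at most [prod_p (alpha_p n_p) * prod_(p in T) (alpha_p H)].  Taking
    for [o] a position of the first set, [H] is, up to a constant, the product [L]
    of logarithms in the hypothesis, and [alpha_p L -> 0] as soon as
    [(K - 1) / 2 >= 1].  If [K = 2] the hypothesis only gives
    [alpha_p sqrt L -> 0], and one logarithm has to be saved in the count of
    solutions of [x_1 x_2 = y_1 y_2]; keeping the column constraints as well does
    this (card_collisions2).  If [K = 1] there is no [T] with [|T| >= 2].

    So the expectation of [Z] is [o(prod_i (alpha_i n_i) ^ k_i)].  Chebyshev's
    inequality gives [|A_i| >= alpha_i n_i / 2] with probability [1 - o(1)]
    (prob_lower_tail), whence [Z = o(Y)] by Markov's inequality, and the two bounds
    on the product set meet. *)

Set Implicit Arguments.
Unset Strict Implicit.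
Unset Printing Implicit Defensive.

Local Open Scope ring_scope.

(** * Factorisation matrices of two equal products *)

(** The part of [m] carried by the first factor can be taken to be the gcd: the
    cofactor is then coprime to what is left of that factor, so by Gauss's lemma
    it divides the product of the others. *)
Lemma dvdn_prod_split (I : eqType) (r : seq I) (x : I -> nat) (m : nat) :
  uniq r -> (forall p, p \in r -> (0 < x p)%N) ->
  (m %| \prod_(p <- r) x p)%N ->
  exists e : I -> nat,
    (forall p, p \in r -> (e p %| x p)%N) /\ (\prod_(p <- r) e p = m)%N.
Proof.
elim: r m => [|p r IHr] m /=.
  move=> _ _; rewrite big_nil dvdn1 => /eqP ->.
  by exists (fun=> 1%N); rewrite big_nil.
move=> /andP[pNr uniq_r] x_gt0; rewrite big_cons => m_dvd.
have xp_gt0 : (0 < x p)%N by apply: x_gt0; rewrite mem_head.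
have g_gt0 : (0 < gcdn m (x p))%N by rewrite gcdn_gt0 xp_gt0 orbT.
have m'_dvd : (m %/ gcdn m (x p) %| \prod_(q <- r) x q)%N.
  have cop : coprime (m %/ gcdn m (x p)) (x p %/ gcdn m (x p)).
    rewrite /coprime -(eqn_pmul2l g_gt0) muln1.
    rewrite muln_gcdr; apply/eqP.
    by congr gcdn; rewrite mulnC divnK ?dvdn_gcdl ?dvdn_gcdr.
  rewrite -(Gauss_dvdr _ cop) -(dvdn_pmul2r g_gt0) mulnAC.
  by rewrite !divnK ?dvdn_gcdl ?dvdn_gcdr.
have [|e [e_dvd e_prod]] := IHr _ uniq_r _ m'_dvd.
  by move=> q qr; apply: x_gt0; rewrite inE qr orbT.
exists (fun q => if q == p then gcdn m (x p) else e q); split.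
  move=> q; rewrite inE; case: eqP => [-> _|_ /=]; first exact: dvdn_gcdr.
  exact: e_dvd.
rewrite big_cons eqxx (eq_big_seq e).
  by rewrite e_prod mulnC divnK ?dvdn_gcdl.
by move=> q qr; case: eqP => // qp; rewrite -qp qr in pNr.
Qed.

(** The columns are split off one at a time: [y q] divides the product of the
    rows, so its divisors [e p] of the [x p] form a column, and the quotients
    [x p / e p] are left for the other columns. *)
Lemma exists_factor_matrix (I : eqType) (r c : seq I) (x y : I -> nat) :
  uniq r -> uniq c -> (forall p, p \in r -> (0 < x p)%N) ->
  (\prod_(p <- r) x p = \prod_(q <- c) y q)%N ->
  exists d : I -> I -> nat,
    (forall p, p \in r -> \prod_(q <- c) d p q = x p)%N /\
    (forall q, q \in c -> \prod_(p <- r) d p q = y q)%N.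
Proof.
move=> uniq_r; elim: c x => [|q c IHc] x /= uniq_c x_gt0.
  rewrite big_nil => x1; exists (fun _ _ => 1%N); split=> // p pr.
  rewrite big_nil; apply/esym/eqP; rewrite -dvdn1 -x1.
  by rewrite (big_rem p)//= dvdn_mulr.
move: uniq_c => /andP[qNc uniq_c]; rewrite big_cons => xy.
have [|e [e_dvd e_prod]] := @dvdn_prod_split _ r x (y q) uniq_r x_gt0.
  by rewrite xy dvdn_mulr.
have e_gt0 p : p \in r -> (0 < e p)%N.
  by move=> pr; apply: dvdn_gt0 (e_dvd _ pr); exact: x_gt0.
have yq_gt0 : (0 < y q)%N by rewrite -e_prod big_seq prodn_cond_gt0.
have [||d [d_row d_col]] := IHc (fun p => x p %/ e p)%N uniq_c.
- by move=> p pr; rewrite divn_gt0 ?e_gt0// dvdn_leq ?x_gt0 ?e_dvd.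
- apply/eqP; rewrite -(eqn_pmul2l yq_gt0) -xy -e_prod -big_split/=.
  by apply/eqP/eq_big_seq => p pr; rewrite mulnC divnK ?e_dvd.
exists (fun p q0 => if q0 == q then e p else d p q0); split=> [p pr|q0].
  rewrite big_cons eqxx (eq_big_seq (d p)).
    by rewrite d_row// mulnC divnK ?e_dvd.
  by move=> q0 q0c; case: eqP => // q0q; rewrite -q0q q0c in qNc.
rewrite inE; case: eqP => [-> //|_ /=]; exact: d_col.
Qed.

(** * Counting collisions *)

Lemma card_ord_itv (M m : nat) : (#|[set v : 'I_M.+1 | 0 < v <= m]| <= m)%N.
Proof.
case: m => [|m]; first by rewrite leqn0 cards_eq0; apply/eqP/setP=> v; rewrite !inE; lia.
rewrite -[X in (_ <= X)%N](card_ord m.+1).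
rewrite -(card_in_imset (f := fun v : 'I_M.+1 => inord v.-1 : 'I_m.+1)) ?max_card//.
move=> u v; rewrite !inE => hu hv /(congr1 val).
rewrite /= !inordK; [move=> huv; apply: val_inj => /=; lia|lia|lia].
Qed.

(** Tuples with bounded entries are coded as functions into ['I_M.+1], with [M]
    a common bound; this is the harmonic sum over such an entry. *)
Lemma sum_ord_inv (R : realFieldType) (M n : nat) : (n <= M)%N ->
  \sum_(v : 'I_M.+1 | (0 < v <= n)%N) (v%:R : R)^-1 = series harmonic n.
Proof.
move=> nM; rewrite big_mkcond big_ord_recl /= add0r.
rewrite /series /= big_mkord (big_ord_widen _ (fun i => harmonic i) nM).
by rewrite [RHS]big_mkcond.
Qed.

Lemma le_natr_div (R : realFieldType) (m d : nat) :
  ((m %/ d)%:R : R) <= m%:R / d%:R.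
Proof.
case: d => [|d]; first by rewrite divn0 mulr_ge0 ?invr_ge0 ?ler0n.
by rewrite ler_pdivlMr ?ltr0n// -natrM ler_nat leq_trunc_div.
Qed.

Section Rows.
Variables (I : finType) (o : I) (n : I -> nat) (M : nat).
Hypothesis n_le : forall q, (n q <= M)%N.

Definition bounded_rows (m : nat) : {set {ffun I -> 'I_M.+1}} :=
  [set d : {ffun I -> 'I_M.+1} | (\prod_q d q <= m)%N &&
    [forall q, (0 < d q)%N && ((q != o) ==> (d q <= n q)%N)]].

(** Once the entries off [o] are chosen, the entry at [o] is at most [m] divided
    by their product; summing [m / prod_(q != o) d q] over the boxes
    [1 <= d q <= n q] factorises into harmonic numbers. *)
Lemma card_bounded_rows (R : realFieldType) (m : nat) :
  #|bounded_rows m|%:R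
    <= m%:R * \prod_(q | q != o) series harmonic (n q) :> R.
Proof.
(* The entry at [o] is forgotten by setting it to [0]. *)
pose upd (d : {ffun I -> 'I_M.+1}) := [ffun q => if q == o then ord0 else d q].
pose Q q : pred 'I_M.+1 := fun v => if q == o then v == ord0 else (0 < v <= n q)%N.
rewrite -sum1_card (partition_big upd (mem (family Q))) /=; last first.
  move=> d; rewrite inE => /andP[_ /forallP dP]; apply/familyP => q.
  rewrite ffunE unfold_in /Q; case: eqP => // /eqP qo.
  by have := dP q; rewrite qo.
rewrite natr_sum.
apply: (@le_trans _ _ (\sum_(d in family Q)
    m%:R * \prod_(q | q != o) ((d q)%:R : R)^-1)).
  apply: ler_sum => e eQ; rewrite sum1dep_card.
  have e_gt0 : (0 < \prod_(q | q != o) e q)%N.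
    apply: prodn_cond_gt0 => q qo; have /familyP/(_ q) := eQ.
    by rewrite unfold_in /Q (negbTE qo) => /andP[].
  apply: (@le_trans _ _ (m %/ \prod_(q | q != o) e q)%:R); last first.
    by apply: le_trans (le_natr_div _ _ _) _; rewrite natr_prod -prodfV.
  rewrite ler_nat; apply: leq_trans (card_ord_itv M _).
  rewrite -(card_in_imset (f := fun d : {ffun I -> 'I_M.+1} => d o)); last first.
    move=> d d'; rewrite !inE => /andP[_ /eqP de] /andP[_ /eqP d'e] dd'.
    apply/ffunP => q; have [->//|/eqP/negbTE qo] := q =P o.
    have := congr1 (fun f : {ffun _} => f q) (etrans de (esym d'e)).
    by rewrite !ffunE qo.
  apply: subset_leq_card; apply/fintype.subsetP => _ /imsetP[d + ->].
  rewrite !inE => /andP[/andP[dm /forallP dP] /eqP de].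
  have := dP o => /andP[-> _] /=; rewrite leq_divRL//; apply: leq_trans dm.
  rewrite [X in (_ <= X)%N](bigD1 o)//= leq_mul2l; apply/orP; right.
  by apply: eq_leq; apply: eq_bigr => q /negbTE qo; rewrite -de ffunE qo.
rewrite -mulr_sumr ler_wpM2l ?ler0n//.
pose G q (v : 'I_M.+1) : R := if q == o then 1 else v%:R^-1.
rewrite (eq_bigr (fun d : {ffun I -> 'I_M.+1} => \prod_q G q (d q))); last first.
  move=> d _; rewrite [RHS](bigD1 o)//= {1}/G eqxx mul1r.
  by apply: eq_bigr => q /negbTE qo; rewrite /G qo.
rewrite -(bigA_distr_big_dep Q G) (bigD1 o)//= /Q /G.
rewrite eqxx big_pred1_eq mul1r le_eqVlt; apply/orP; left.
apply/eqP/eq_bigr => q /negbTE ->; exact: sum_ord_inv.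
Qed.

End Rows.

Section Collisions.
Variables (I : finType) (n : I -> nat) (M : nat).
Hypothesis n_le : forall q, (n q <= M)%N.
Local Notation tup := {ffun I -> 'I_M.+1}.

Definition collisions (T : {set I}) : {set tup * tup} :=
  [set xy : tup * tup |
    [&& [forall p, (0 < xy.1 p <= n p) && (0 < xy.2 p <= n p)]%N,
        [forall p, (p \notin T) ==> (xy.1 p == xy.2 p)]
      & (\prod_(p in T) xy.1 p == \prod_(p in T) xy.2 p)%N]].

(** The factor matrix of the equation over [T], completed by the common values of
    [x] and [y] on the diagonal off [T]. *)
Lemma collision_matrix (T : {set I}) x y : (x, y) \in collisions T ->
  exists e : I -> I -> nat,
    [/\ forall p, (\prod_q e p q = x p)%N,
        forall q, (\prod_p e p q = y q)%N,
        forall p q, (0 < e p q)%N &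
        forall p q, q != p -> (p \notin T) || (q \notin T) -> e p q = 1%N].
Proof.
rewrite inE /= => /and3P[/forallP xy_le /forallP xyN /eqP xyT].
have x_gt0 p : (0 < x p)%N by case/andP: (xy_le p) => /andP[].
have y_gt0 p : (0 < y p)%N by case/andP: (xy_le p) => _ /andP[].
have [||||d] := @exists_factor_matrix _ (enum T) (enum T) (fun p => x p) (fun p => y p).
- exact: enum_uniq.
- exact: enum_uniq.
- by [].
- by rewrite !big_enum.
move=> [d_row d_col].
have {}d_row p : p \in T -> (\prod_(q in T) d p q = x p)%N.
  by move=> pT; rewrite -d_row ?mem_enum// big_enum.
have {}d_col q : q \in T -> (\prod_(p in T) d p q = y q)%N.
  by move=> qT; rewrite -d_col ?mem_enum// big_enum.
exists (fun p q => if p \in T then if q \in T then d p q else 1%N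
                   else if q == p then nat_of_ord (x p) else 1%N).
split=> [p|q|p q|p q qp].
- have [pT|pT] := boolP (p \in T).
    by rewrite -d_row// [RHS]big_mkcond.
  by rewrite -big_mkcond big_pred1_eq.
- have [qT|qT] := boolP (q \in T).
    rewrite -d_col// [RHS]big_mkcond; apply: eq_bigr => p _.
    by case: ifPn => // pT; case: eqP => // qp; rewrite qp (negbTE pT) in qT.
  rewrite (bigD1 q)//= (negbTE qT) eqxx big1 ?muln1 => [|p pq].
    by have := xyN q; rewrite qT => /eqP ->.
  by rewrite eq_sym (negbTE pq); case: ifP.
- case: ifPn => pT; last by case: ifP => // _; exact: x_gt0.
  case: ifPn => // qT; rewrite lt0n; apply: contraL (x_gt0 p) => /eqP d0.
  by rewrite -(d_row p pT) (bigD1 q)//= d0 mul0n.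
- by rewrite (negbTE qp); case: (p \in T) => //=; case: (q \in T).
Qed.

(** A collision is recovered from its matrix, whose rows can be bounded
    separately: a row in [T] is a bounded row, and a row [p] off [T] has only its
    diagonal entry free. *)
Lemma card_collisions (R : realFieldType) (o : I) (T : {set I}) :
  #|collisions T|%:R <= \prod_p (n p)%:R *
    \prod_(p in T) \prod_(q | q != o) series harmonic (n q) :> R.
Proof.
pose diag p : {set tup} :=
  [set d : tup | (0 < d p <= n p)%N && [forall q, (q != p) ==> (d q == 1 :> nat)%N]].
pose rows p : pred tup :=
  fun d => if p \in T then d \in bounded_rows o n M (n p) else d \in diag p.
pose h (d : {ffun I -> tup}) : tup * tup :=
  ([ffun p => inord (\prod_q d p q)], [ffun q => inord (\prod_p d p q)]).
have sub : collisions T \subset h @: [set d | d \in family rows].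
  apply/fintype.subsetP => -[x y] xyP; have := xyP.
  rewrite inE /= => /and3P[/forallP xy_le _ _].
  have [e [e_row e_col e_gt0 e1]] := collision_matrix xyP.
  have e_lex p q : (e p q <= x p)%N.
    case/andP: (xy_le p) => /andP[x_gt0 _] _; apply: dvdn_leq => //.
    by rewrite -(e_row p) (bigD1 q)//= dvdn_mulr.
  have e_ley p q : (e p q <= y q)%N.
    case/andP: (xy_le q) => _ /andP[y_gt0 _]; apply: dvdn_leq => //.
    by rewrite -(e_col q) (bigD1 p)//= dvdn_mulr.
  have eM p q : (e p q < M.+1)%N.
    by rewrite ltnS (leq_trans (e_lex p q))// -ltnS.
  apply/imsetP; exists [ffun p => [ffun q => inord (e p q)]].
    rewrite inE; apply/familyP => p; rewrite unfold_in /rows !ffunE.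
    case: ifPn => pT; rewrite inE.
      apply/andP; split.
        under eq_bigr do rewrite ffunE inordK//.
        by rewrite e_row; case/andP: (xy_le p) => /andP[].
      apply/forallP => q; rewrite ffunE inordK// e_gt0/=; apply/implyP => _.
      by rewrite (leq_trans (e_ley p q))//; case/andP: (xy_le q) => _ /andP[].
    rewrite ffunE inordK// e_gt0 (leq_trans (e_lex p p))/=; last first.
      by case/andP: (xy_le p) => /andP[].
    apply/forallP => q; apply/implyP => qp; rewrite ffunE inordK// e1//.
    by rewrite pT.
  congr pair; apply/ffunP => p; rewrite ffunE; apply: val_inj.
    under eq_bigr do rewrite !ffunE inordK//.
    by rewrite /= e_row inordK.
  under eq_bigr do rewrite !ffunE inordK//.
  by rewrite /= e_col inordK.
have card_rows p : #|rows p|%:R <=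
    (n p)%:R * (if p \in T then \prod_(q | q != o) series harmonic (n q)
                else 1) :> R.
  rewrite /rows; case: ifP => pT.
    rewrite (@eq_card _ _ (mem (bounded_rows o n M (n p)))).
      exact: card_bounded_rows.
    by [].
  rewrite mulr1 ler_nat (@eq_card _ _ (mem (diag p))); last first.
    by [].
  apply: leq_trans (card_ord_itv M _).
  rewrite -(card_in_imset (f := fun d : tup => d p)); last first.
    move=> d d'; rewrite !inE => /andP[_ /forallP d1] /andP[_ /forallP d'1] dd'.
    apply/ffunP => q; have [->//|/eqP qo] := q =P p.
    apply: val_inj; have /implyP/(_ qo)/eqP d1q := d1 q.
    by have /implyP/(_ qo)/eqP d'1q := d'1 q; rewrite /= d1q d'1q.
  apply: subset_leq_card; apply/fintype.subsetP => _ /imsetP[d + ->].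
  by rewrite !inE => /andP[].
apply: (@le_trans _ _ #|[set d | d \in family rows]|%:R).
  by rewrite ler_nat (leq_trans (subset_leq_card sub))// leq_imset_card.
rewrite cardsE card_family foldrE big_image /= natr_prod.
rewrite [X in _ * X]big_mkcond -big_split /=.
by apply: ler_prod => p _; rewrite ler0n card_rows.
Qed.

End Collisions.

(** For a given maximum [b] the other entry takes at most [b] values, so that each
    of the two cases [c <= b] and [b <= c] contributes [sum_b b / b ^ 2]. *)
Lemma sum_inv_sqr_maxn (R : realFieldType) (M n : nat) : (n <= M)%N ->
  \sum_(u : 'I_M.+1 * 'I_M.+1 | (0 < u.1 <= n)%N && (0 < u.2 <= n)%N)
    ((maxn u.1 u.2)%:R ^- 2 : R) <= 2 * series harmonic n.
Proof.
move=> nM; pose J : pred 'I_M.+1 := fun b => (0 < b <= n)%N.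
have half : \sum_(b | J b) \sum_(c | J c)
    (if (c <= b)%N then b%:R ^- 2 else 0 : R) <= series harmonic n.
  rewrite -(sum_ord_inv R nM); apply: ler_sum => b /andP[b_gt0 bn].
  rewrite -big_mkcondr /= sumr_const.
  rewrite (@le_trans _ _ ((b%:R ^- 2) *+ b))//.
    rewrite ler_wpMn2l ?invr_ge0 ?exprn_ge0 ?ler0n//.
    rewrite -cardsE; apply: leq_trans (card_ord_itv M b).
    apply: subset_leq_card; apply/fintype.subsetP => c; rewrite !inE unfold_in /J.
    by move=> /andP[/andP[-> _] ->].
  by rewrite -[X in X <= _]mulr_natr expr2 invfM -mulrA mulVf ?mulr1// pnatr_eq0 -lt0n.
rewrite -(pair_big J J (fun b c : 'I_M.+1 => (maxn b c)%:R ^- 2 : R)) /=.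
rewrite mulr_natl mulr2n; apply: le_trans (lerD half half).
rewrite [X in _ <= _ + X]exchange_big /= -big_split /=.
apply: ler_sum => b _; rewrite -big_split /=; apply: ler_sum => c _.
have V_ge0 m : 0 <= (m%:R ^- 2 : R) by rewrite invr_ge0 exprn_ge0// ler0n.
have [cb|bc] := leqP c b.
  by rewrite lerDl; case: ifP.
by rewrite (ltnW bc) add0r.
Qed.

Section PairCollisions.
Variables (I : finType) (n : I -> nat) (M : nat).
Hypothesis n_le : forall q, (n q <= M)%N.

(** With two positions [o] and [r], a collision is [x o = g b], [x r = c e],
    [y o = g c], [y r = b e].  Given [b] and [c], both row and column constraints
    bound [g] by [n o / max(b, c)] and [e] by [n r / max(b, c)]; the square of the
    maximum in the denominator leaves a single harmonic number, where the row
    constraints alone would leave its square. *)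
Lemma card_collisions2 (R : realFieldType) (o : I) (T : {set I}) :
  #|I| = 2%N ->
  #|collisions n M T|%:R <= 2 * \prod_p (n p)%:R *
    \prod_(q | q != o) series harmonic (n q) :> R.
Proof.
move=> I2; pose V := 'I_M.+1.
have /cards1P[r oC] : #|[set~ o]| == 1%N by rewrite cardsC1 I2.
have neq_o q : (q != o) = (q == r).
  by have := in_setC1 q o; rewrite oC inE => ->.
have r_neq : r != o by rewrite neq_o.
have prodE (S : Type) (idx : S) (op : Monoid.com_law idx) (F : I -> S) :
    \big[op/idx]_p F p = op (F o) (F r).
  rewrite (bigD1 o)//=; congr (op _ _).
  by rewrite (eq_bigl (pred1 r)) ?big_pred1_eq.
have sub_full : collisions n M T \subset collisions n M [set: I].
  apply/fintype.subsetP => -[x y]; rewrite !inE /=.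
  move=> /and3P[-> /forallP xyN /eqP xyT] /=; apply/andP; split.
    by apply/forallP => p; rewrite inE.
  rewrite (big_setID T)/= [X in _ == X](big_setID T)/= !finset.setTI !finset.setTD xyT.
  apply/eqP; congr (_ * _)%N; apply: eq_bigr => p.
  by rewrite inE => pT; have /implyP/(_ pT)/eqP -> := xyN p.
pose E (u : V * V) : {set V * V} :=
  [set v : V * V | (0 < v.1 <= n o %/ maxn u.1 u.2) && (0 < v.2 <= n r %/ maxn u.1 u.2)]%N.
pose D : {set (V * V) * (V * V)} :=
  [set z : (V * V) * (V * V) | [&& 0 < z.1.1 <= n r, 0 < z.1.2 <= n r & z.2 \in E z.1]%N].
pose h (z : (V * V) * (V * V)) : {ffun I -> V} * {ffun I -> V} :=
  ([ffun p => if p == o then inord (z.2.1 * z.1.1) else inord (z.1.2 * z.2.2)],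
   [ffun p => if p == o then inord (z.2.1 * z.1.2) else inord (z.1.1 * z.2.2)]).
have sub : collisions n M [set: I] \subset h @: D.
  apply/fintype.subsetP => -[x y] xyP; have := xyP.
  rewrite inE /= => /and3P[/forallP xy_le _ _].
  have [e [e_row e_col e_gt0 _]] := collision_matrix xyP.
  have := e_row o; have := e_row r; have := e_col o; have := e_col r.
  rewrite !prodE /= => yr yo xr xo.
  have /andP[/andP[_ xno] /andP[_ yno]] := xy_le o.
  have /andP[/andP[_ xnr] /andP[_ ynr]] := xy_le r.
  have lt_ord p q : (e p q < M.+1)%N.
    rewrite ltnS; apply: leq_trans (n_le p); have /andP[/andP[x_gt0 xn] _] := xy_le p.
    by apply: leq_trans xn; rewrite dvdn_leq// -(e_row p) (bigD1 q)//= dvdn_mulr.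
  apply/imsetP.
  exists ((inord (e o r), inord (e r o)), (inord (e o o), inord (e r r))).
    rewrite !inE /= !inordK//.
    have m_gt0 : (0 < maxn (e o r) (e r o))%N by rewrite leq_max e_gt0.
    rewrite !leq_divRL// !e_gt0 /= !maxnMr !geq_max.
    rewrite xo yo mulnC yr mulnC xr xno yno xnr ynr /=.
    rewrite !andbT; apply/andP; split.
      by apply: leq_trans ynr; rewrite -yr leq_pmulr.
    by apply: leq_trans xnr; rewrite -xr leq_pmulr.
  by congr pair; apply/ffunP => p; rewrite ffunE /= !inordK// ?xo ?yo ?xr ?yr;
     have [->|/eqP] := p =P o; rewrite ?inord_val// neq_o => /eqP ->.
apply: (@le_trans _ _ #|D|%:R).
  rewrite ler_nat (leq_trans (subset_leq_card sub_full))//.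
  by rewrite (leq_trans (subset_leq_card sub))// leq_imset_card.
have -> : #|D| = (\sum_(u : V * V | (0 < u.1 <= n r) && (0 < u.2 <= n r)) #|E u|)%N.
  under [RHS]eq_bigr do rewrite -sum1_card.
  rewrite pair_big_dep /= -sum1_card; apply: eq_bigl => z.
  by rewrite inE andbA.
rewrite natr_sum.
apply: (@le_trans _ _ (\sum_(u : V * V | (0 < u.1 <= n r)%N && (0 < u.2 <= n r)%N)
   (n o)%:R * (n r)%:R * ((maxn u.1 u.2)%:R ^- 2 : R))).
  apply: ler_sum => u _.
  have -> : E u = finset.setX [set v : V | 0 < v <= n o %/ maxn u.1 u.2]%N
                       [set v : V | 0 < v <= n r %/ maxn u.1 u.2]%N.
    by apply/setP => v; rewrite !inE.
  rewrite cardsX natrM -exprVn expr2 mulrACA.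
  by apply: ler_pM; rewrite ?ler0n// (le_trans _ (le_natr_div _ _ _))// ler_nat card_ord_itv.
rewrite -mulr_sumr !prodE /= (eq_bigl (pred1 r)) ?big_pred1_eq//.
rewrite [2 * _]mulrC -[X in _ <= X]mulrA ler_wpM2l ?mulr_ge0 ?ler0n//.
exact: sum_inv_sqr_maxn.
Qed.

(** The two counts in a common form: each position of [T] costs a factor [nu].
    The hypothesis for two positions is the weaker one [H <= nu ^ 2], because
    there the single factor [H] is shared by both positions. *)
Lemma card_collisions_weighted (R : realFieldType) (o : I) (T : {set I}) (nu : R) :
  ((2 < #|I|)%N -> \prod_(q | q != o) series harmonic (n q) <= nu) ->
  (#|I| = 2%N -> \prod_(q | q != o) series harmonic (n q) <= nu ^+ 2) ->
  (1 < #|T|)%N ->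
  #|collisions n M T|%:R <= 2 * \prod_p (n p)%:R * \prod_(p in T) nu :> R.
Proof.
move=> nu3 nu2 T2; have TI : (#|T| <= #|I|)%N := max_card T.
have n_ge0 : 0 <= \prod_p (n p)%:R :> R by apply: prodr_ge0 => p _; rewrite ler0n.
have h_ge0 : 0 <= \prod_(q | q != o) series harmonic (n q) :> R.
  by apply: prodr_ge0 => q _; apply: sumr_ge0 => i _; exact: harmonic_ge0.
have [I3|I2] := ltnP 2 #|I|.
  apply: le_trans (card_collisions n_le R o T) _.
  apply: (@le_trans _ _ (\prod_p (n p)%:R * \prod_(p in T) nu)).
    by rewrite ler_wpM2l// ler_prod// => p _; rewrite h_ge0 nu3.
  rewrite -[X in _ <= X]mulrA ler_peMl ?ler1n// mulr_ge0// prodr_ge0// => p _.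
  exact: le_trans (nu3 I3).
have {}I2 : #|I| = 2%N by apply/eqP; rewrite eqn_leq I2 (leq_trans T2).
apply: le_trans (card_collisions2 R o T I2) _.
rewrite ler_wpM2l ?mulr_ge0 ?ler0n// prodr_const.
have -> : #|T| = 2%N by apply/eqP; rewrite eqn_leq T2 andbT -I2.
exact: nu2.
Qed.

End PairCollisions.

(** * Upper bound for the product set *)

Section ProductSets.
Local Open Scope fset_scope.
Local Open Scope ring_scope.

Lemma prodsetP (A B : {fset nat}) x :
  reflect (exists a b, [/\ a \in A, b \in B & x = (a * b)%N])
          (x \in prodset A B).
Proof.
apply: (iffP idP) => [/imfset2P[a aA [b bB ->]]|[a [b [aA bB ->]]]].
  by exists a, b.
by apply/imfset2P; exists a => //; exists b.
Qed.

Lemma card_prodset (A B : {fset nat}) :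
  (#|` prodset A B| <= #|` A| * #|` B|)%N.
Proof.
rewrite -(size_allpairs muln) uniq_leq_size ?fset_uniq// => x.
move=> /prodsetP[a [b [aA bB ->]]]; apply/allpairsP; exists (a, b).
by split.
Qed.

(** If one of the factors is [a], it can be moved to the front. *)
Lemma powsetU1_sub (a : nat) (A : {fset nat}) k x :
  x \in powset (a |` A) k.+1 ->
  x \in powset A k.+1 \/ exists2 y, y \in powset (a |` A) k & x = (a * y)%N.
Proof.
elim: k x => [|k IHk] x /= /prodsetP[b [c [bA cP ->]]]; move: bA;
  rewrite !inE => /orP[/eqP ->|bA]; try by right; exists c.
- by left; apply/prodsetP; exists b, c.
- case: (IHk _ cP) => [cA|[y yP ->]].
    by left; apply/prodsetP; exists b, c.
  right; exists (b * y)%N; last by rewrite mulnCA.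
  by apply/prodsetP; exists b, y; rewrite !inE bA orbT.
Qed.

(** The number of multisets of size [k], through Pascal's rule: a product of
    [k + 1] elements of [a |` A] either avoids [a] or is [a] times a product of
    [k] elements. *)
Lemma card_powset (A : {fset nat}) (k : nat) :
  (#|` powset A k| <= 'C((#|` A| + k).-1, k))%N.
Proof.
elim/fset1U_rect: A k => [|a A aNA IHA] k.
  case: k => [|k]; first by rewrite cardfs1.
  suff -> : powset fset0 k.+1 = fset0 by rewrite cardfs0.
  apply/fsetP => x; rewrite !inE; apply/negbTE/negP => /prodsetP[b [c []]].
  by rewrite inE.
elim: k => [|k IHk]; first by rewrite cardfs1 bin0.
have IHA' := IHA k.+1; rewrite cardfsU1 aNA add1n in IHk *.
move: IHk IHA'; rewrite !addSn !addnS /= binS => IHk IHA'.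
apply: leq_trans (leq_add IHA' IHk).
rewrite -(size_map (muln a) (powset (a |` A) k)) -size_cat.
apply: uniq_leq_size (fset_uniq _) _ => x /powsetU1_sub[xA|[y yP ->]].
  by rewrite mem_cat xA.
by rewrite mem_cat map_f ?orbT.
Qed.

Lemma card_prodpowset (s : nat) (A : 'I_s -> {fset nat}) (k : 'I_s -> nat) :
  (#|` prodpowset A k| <= \prod_i 'C((#|` A i| + k i).-1, k i))%N.
Proof.
rewrite /prodpowset.
apply: (big_rec2 (fun (B : {fset nat}) m => #|` B| <= m)%N).
  by rewrite cardfs1.
move=> i B m _ Bm; apply: leq_trans (card_prodset _ _) _.
exact: leq_mul (card_powset _ _) Bm.
Qed.

Lemma mem_powset (A : {fset nat}) (I : eqType) (r : seq I) (v : I -> nat) :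
  (forall i, i \in r -> v i \in A) -> (\prod_(i <- r) v i)%N \in powset A (size r).
Proof.
elim: r => [|i r IHr] vA; first by rewrite big_nil inE.
rewrite big_cons /=; apply/prodsetP; exists (v i), (\prod_(j <- r) v j)%N.
by split=> //; [rewrite vA ?mem_head|apply: IHr => j jr; rewrite vA// inE jr orbT].
Qed.

Lemma mem_prodpowset (s : nat) (A : 'I_s -> {fset nat}) (k : 'I_s -> nat)
  (v : 'I_s -> nat) :
  (forall i, v i \in powset (A i) (k i)) -> (\prod_i v i)%N \in prodpowset A k.
Proof.
move=> vA; rewrite /prodpowset.
apply: (big_rec2 (fun m (B : {fset nat}) => m \in B)).
  by rewrite inE.
by move=> i m B _ mB; apply/prodsetP; exists (v i), m.
Qed.

Lemma card_ord_mem (M : nat) (B : {fset nat}) :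
  (forall m, m \in B -> (m <= M)%N) -> #|[set v : 'I_M.+1 | val v \in B]| = #|` B|.
Proof.
move=> BM; rewrite cardE -(size_map val).
apply/eqP; rewrite eqn_leq; apply/andP; split.
  apply: uniq_leq_size => [|m /mapP[v]].
    by rewrite (map_inj_uniq val_inj) enum_uniq.
  by rewrite mem_enum inE => vB ->.
apply: uniq_leq_size (fset_uniq _) _ => m mB.
have mM : (m < M.+1)%N by rewrite ltnS BM.
by apply/mapP; exists (Ordinal mM) => //; rewrite mem_enum inE.
Qed.

End ProductSets.

(** * Collisions between families of subsets *)

Section AlignedEnumeration.
Variables (V : finType) (v0 : V) (S S' : {set V}).

(** Listing the common elements first makes the enumerations of [S] and of [S']
    agree exactly on an initial segment. *)
Definition aligned_enum : seq V := enum (S :&: S') ++ enum (S :\: S').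

Lemma perm_aligned_enum : perm_eq aligned_enum (enum S).
Proof.
apply: uniq_perm => [||v]; first 1 last.
- exact: enum_uniq.
- by rewrite mem_cat !mem_enum !inE; case: (v \in S'); rewrite ?andbF ?orbF ?andbT.
- rewrite cat_uniq !enum_uniq andbT /=; apply/hasPn => v.
  by rewrite !mem_enum !inE => /andP[/negbTE -> _]; rewrite andbF.
Qed.

Lemma size_aligned_enum : size aligned_enum = #|S|.
Proof. by rewrite (perm_size perm_aligned_enum) -cardE. Qed.

Lemma aligned_enum_uniq : uniq aligned_enum.
Proof. by rewrite (perm_uniq perm_aligned_enum) enum_uniq. Qed.

Lemma mem_aligned_enum v : (v \in aligned_enum) = (v \in S).
Proof. by rewrite (perm_mem perm_aligned_enum) mem_enum. Qed.

Lemma nth_aligned_enum_new j : (#|S :&: S'| <= j < #|S|)%N ->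
  nth v0 aligned_enum j \notin S'.
Proof.
move=> /andP[jge jlt]; rewrite nth_cat -cardE ltnNge jge /=.
have : nth v0 (enum (S :\: S')) (j - #|S :&: S'|) \in enum (S :\: S').
  by rewrite mem_nth// -cardE; move: jlt; rewrite -(cardsID S' S); lia.
by rewrite mem_enum inE => /andP[].
Qed.

End AlignedEnumeration.

Lemma nth_aligned_enum_common (V : finType) (v0 : V) (S S' : {set V}) j :
  (j < #|S :&: S'|)%N ->
  nth v0 (aligned_enum S S') j = nth v0 (aligned_enum S' S) j.
Proof. by move=> jlt; rewrite !nth_cat -!cardE [S' :&: S]finset.setIC jlt. Qed.

Section Positions.
Variables (s : nat) (k n : 'I_s -> nat) (M : nat).

Definition position := {i : 'I_s & 'I_(k i)}.

Local Notation tup := {ffun position -> 'I_M.+1}.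

(** What makes the memberships of the values [x p], and of the [y p] with [p] in
    [T], distinct events. *)
Definition separated (T : {set position}) (x y : tup) : bool :=
  [&& [forall p, forall q, (tag p == tag q) ==> (x p == x q) ==> (p == q)],
      [forall p, forall q, (tag p == tag q) ==> (y p == y q) ==> (p == q)]
    & [forall p, forall q, (p \in T) ==> (tag p == tag q) ==> (y p != x q)]].

(** The set [T] is recorded because the probability of being captured depends
    on it. *)
Definition bad_collisions : {set {set position} * (tup * tup)} :=
  [set z : {set position} * (tup * tup) |
    [&& (1 < #|z.1|)%N, z.2 \in collisions (fun p => n (tag p)) M z.1
      & separated z.1 z.2.1 z.2.2]].

Definition captured (A : 'I_s -> {fset nat}) (z : {set position} * (tup * tup)) :=
  [forall p, (val (z.2.1 p) \in A (tag p)) && (val (z.2.2 p) \in A (tag p))].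

Definition bad_count (A : 'I_s -> {fset nat}) : nat :=
  #|[set z in bad_collisions | captured A z]|.

Lemma prod_nth_position (S : 'I_s -> seq 'I_M.+1) : (forall i, size (S i) = k i) ->
  (\prod_(p : position) nth ord0 (S (tag p)) (tagged p) =
   \prod_i \prod_(v <- S i) v)%N.
Proof.
move=> sizeS.
rewrite -(sig_big_dep xpredT (fun _ => xpredT)
  (fun i (j : 'I_(k i)) => nat_of_ord (nth ord0 (S i) j))) /=.
by apply: eq_bigr => i _; rewrite (big_nth ord0) sizeS big_mkord.
Qed.

(** The tuples are the aligned enumerations of the [S i] and of the [S' i], and
    [T] is the set of positions beyond the common elements.  It cannot be empty,
    since the families differ, nor a singleton, since one remaining factor is
    determined by the product. *)
Lemma bad_collision_of_subsets (S S' : 'I_s -> {set 'I_M.+1}) :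
  (forall i, #|S i| = k i) -> (forall i, #|S' i| = k i) ->
  (forall i v, v \in S i -> (0 < v <= n i)%N) ->
  (forall i v, v \in S' i -> (0 < v <= n i)%N) ->
  (\prod_i \prod_(v in S i) v = \prod_i \prod_(v in S' i) v)%N ->
  (exists i, S i != S' i) ->
  exists2 z, z \in bad_collisions &
    forall i v, ((v \in S i) = [exists p, (tag p == i) && (z.2.1 p == v)]) *
                ((v \in S' i) = [exists p, (tag p == i) && (z.2.2 p == v)]).
Proof.
move=> cardS cardS' leS leS' prodS neqS.
pose l i := aligned_enum (S i) (S' i); pose l' i := aligned_enum (S' i) (S i).
have size_l i : size (l i) = k i by rewrite size_aligned_enum.
have size_l' i : size (l' i) = k i by rewrite size_aligned_enum.
pose x : tup := [ffun p : position => nth ord0 (l (tag p)) (tagged p)].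
pose y : tup := [ffun p : position => nth ord0 (l' (tag p)) (tagged p)].
pose T : {set position} := [set p : position | #|S (tag p) :&: S' (tag p)| <= tagged p]%N.
have xS p : x p \in S (tag p).
  by rewrite ffunE -(mem_aligned_enum _ (S' (tag p))) mem_nth// size_l.
have yS p : y p \in S' (tag p).
  by rewrite ffunE -(mem_aligned_enum _ (S (tag p))) mem_nth// size_l'.
have xT p : p \in T -> x p \notin S' (tag p).
  by rewrite inE ffunE => pT; apply: nth_aligned_enum_new; rewrite pT cardS /=.
have yT p : p \in T -> y p \notin S (tag p).
  rewrite inE ffunE => pT; apply: nth_aligned_enum_new.
  by rewrite finset.setIC pT cardS' /=.
have xyN p : p \notin T -> x p = y p.
  by rewrite inE -ltnNge !ffunE; exact: nth_aligned_enum_common.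
have imS i v : (v \in S i) = [exists p, (tag p == i) && (x p == v)].
  apply/idP/existsP => [vS|[p /andP[/eqP <- /eqP <-]]]; last exact: xS.
  have vl : v \in l i by rewrite mem_aligned_enum.
  have vk : (index v (l i) < k i)%N by rewrite -size_l index_mem.
  by exists (Tagged (fun i => 'I_(k i)) (Ordinal vk)); rewrite ffunE eqxx nth_index /=.
have imS' i v : (v \in S' i) = [exists p, (tag p == i) && (y p == v)].
  apply/idP/existsP => [vS|[p /andP[/eqP <- /eqP <-]]]; last exact: yS.
  have vl : v \in l' i by rewrite mem_aligned_enum.
  have vk : (index v (l' i) < k i)%N by rewrite -size_l' index_mem.
  by exists (Tagged (fun i => 'I_(k i)) (Ordinal vk)); rewrite ffunE eqxx nth_index /=.
have x_gt0 p : (0 < x p)%N by case/andP: (leS _ _ (xS p)).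
have prod_l (U U' : 'I_s -> {set 'I_M.+1}) :
    (\prod_i \prod_(v <- aligned_enum (U i) (U' i)) v =
     \prod_i \prod_(v in U i) v)%N.
  apply: eq_bigr => i _; rewrite (perm_big _ (perm_aligned_enum _ _)).
  by rewrite big_enum.
have prodxy : (\prod_p x p = \prod_p y p)%N.
  under eq_bigr do rewrite ffunE; under [RHS]eq_bigr do rewrite ffunE.
  by rewrite !prod_nth_position// !prod_l.
have prodT : (\prod_(p in T) x p = \prod_(p in T) y p)%N.
  move: prodxy; rewrite (bigID (mem T)) [RHS](bigID (mem T)) /=.
  rewrite (eq_bigr (fun p => nat_of_ord (y p)) (P := fun p => p \notin T)).
    move=> /eqP; rewrite eqn_pmul2r; first by move/eqP.
    by apply: prodn_cond_gt0 => p /xyN <-.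
  by move=> p /xyN ->.
exists (T, (x, y)); last by move=> i v; split; rewrite ?imS ?imS'.
rewrite inE /=; apply/and3P; split.
- rewrite ltnNge; apply/negP => /card_le1P T1; case: neqS => i /eqP; apply.
  have [T0|[p pT]] := set_0Vmem T.
    apply/setP => v; rewrite imS imS'; apply: eq_existsb => p.
    by rewrite xyN// T0 inE.
  have Tp : T = [set p].
    by apply/setP => q; rewrite inE; have := T1 p pT q; rewrite inE.
  have := xT p pT; suff -> : x p = y p by rewrite yS.
  by apply: val_inj; move: prodT; rewrite Tp !big_set1.
- rewrite inE /=; apply/and3P; split.
  + by apply/forallP => p; rewrite leS// leS'.
  + by apply/forallP => p; apply/implyP => /xyN ->.
  + by rewrite prodT.
- have inj (m : 'I_s -> seq 'I_M.+1) (p q : position) :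
      (forall i, size (m i) = k i) -> (forall i, uniq (m i)) -> tag p = tag q ->
      nth ord0 (m (tag p)) (tagged p) = nth ord0 (m (tag q)) (tagged q) -> p = q.
    move=> size_m uniq_m; case: p q => [i j] [i' j'] /= ii'; subst i'.
    move=> /eqP; rewrite nth_uniq ?size_m// => /eqP jj'.
    by congr existT; apply: val_inj.
  apply/and3P; split.
  + apply/forallP => p; apply/forallP => q; apply/implyP => /eqP pq.
    apply/implyP; rewrite !ffunE => /eqP xpq; apply/eqP.
    by apply: inj pq xpq => // i; exact: aligned_enum_uniq.
  + apply/forallP => p; apply/forallP => q; apply/implyP => /eqP pq.
    apply/implyP; rewrite !ffunE => /eqP xpq; apply/eqP.
    by apply: inj pq xpq => // i; exact: aligned_enum_uniq.
  + apply/forallP => p; apply/forallP => q; apply/implyP => pT.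
    apply/implyP => /eqP pq; apply: contraNneq (yT p pT) => ->.
    by rewrite pq xS.
Qed.

End Positions.

(** Among the families of subsets with a given product, one is chosen as
    representative.  The representatives inject into the product set, and a
    family that is not a representative collides with its representative in a
    configuration from which it can be read off. *)
Lemma prod_bin_le_card (s : nat) (k n : 'I_s -> nat) (M : nat)
    (A : 'I_s -> {fset nat}) :
  (forall i, (n i <= M)%N) ->
  (forall i m, m \in A i -> (1 <= m <= n i)%N) ->
  (\prod_i 'C(#|` A i|, k i) <= #|` prodpowset A k| + bad_count k n M A)%N.
Proof.
move=> nM A_le; pose V := 'I_M.+1.
pose B i : {set V} := [set v : V | val v \in A i].
pose choices i : pred {set V} := fun U => (U \subset B i) && (#|U| == k i).
pose X : {set {ffun 'I_s -> {set V}}} := [set S in family choices].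
have XP S : S \in X -> forall i, (S i \subset B i) /\ (#|S i| = k i).
  by rewrite inE => /familyP XS i; have /andP[? /eqP] := XS i.
pose f (S : {ffun 'I_s -> {set V}}) := (\prod_i \prod_(v in S i) v)%N.
pose rep S := odflt S [pick S' in X | f S' == f S].
have repP S : S \in X -> rep S \in X /\ f (rep S) = f S.
  move=> SX; rewrite /rep; case: pickP => [S' /andP[? /eqP]|] //.
have rep_eq S S' : S \in X -> S' \in X -> f S = f S' -> rep S = rep S'.
  move=> SX S'X fSS'; rewrite /rep.
  rewrite (@eq_pick _ _ (fun U => (U \in X) && (f U == f S'))); last first.
    by move=> U; rewrite /= fSS'.
  by case: pickP => //= /(_ S'); rewrite S'X eqxx.
have cardX : #|X| = (\prod_i 'C(#|` A i|, k i))%N.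
  rewrite cardsE card_family foldrE big_image /=; apply: eq_bigr => i _.
  rewrite -(@card_ord_mem M); last first.
    by move=> m /A_le /andP[_ mn]; apply: leq_trans (nM i).
  by rewrite -cards_draws cardsE.
rewrite -cardX -(cardsID [set S | rep S == S] X) leq_add//.
  rewrite cardE -(size_map f); apply: uniq_leq_size => [|m /mapP[S]].
    rewrite map_inj_in_uniq ?enum_uniq// => S S'.
    rewrite !mem_enum => /setIP[SX +] /setIP[S'X +] fSS'.
    rewrite inE => /eqP repS; rewrite inE => /eqP repS'.
    by rewrite -repS -repS'; exact: rep_eq.
  rewrite mem_enum finset.in_setI => /andP[/XP SX _] ->.
  apply: mem_prodpowset => i; have [/fintype.subsetP SB <-] := SX i.
  rewrite cardE -big_enum /=; apply: (mem_powset (v := fun v : V => val v)) => v.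
  by rewrite mem_enum => /SB; rewrite inE.
pose h (z : {set position k} * ({ffun position k -> V} * {ffun position k -> V})) :=
  [ffun i => [set v | [exists p, (tag p == i) && (z.2.1 p == v)]]].
rewrite (leq_trans _ (leq_imset_card h _))//; apply: subset_leq_card.
apply/fintype.subsetP => S; rewrite finset.in_setD [S \in [set _ | _]]inE => /andP[repS SX].
have [/XP rX fr] := repP _ SX; have {}SX := XP _ SX.
have le_n i v : v \in B i -> (0 < v <= n i)%N by rewrite inE => /A_le.
have [||||||z z_bad zP] := @bad_collision_of_subsets s k n M S (rep S).
- by move=> i; have [] := SX i.
- by move=> i; have [] := rX i.
- by move=> i v vS; have [/fintype.subsetP/(_ _ vS)/le_n] := SX i.
- by move=> i v vS; have [/fintype.subsetP/(_ _ vS)/le_n] := rX i.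
- by rewrite -/(f S) -fr.
- apply/existsP; apply: contraR repS => /existsPn SrS; apply/eqP/ffunP => i.
  by apply/esym/eqP; have := SrS i; rewrite negbK.
apply/imsetP; exists z; last first.
  by apply/ffunP => i; rewrite ffunE; apply/setP => v; rewrite inE (zP i v).1.
rewrite inE z_bad /=; apply/forallP => p; apply/andP; split.
  have [/fintype.subsetP SB _] := SX (tag p).
  have : z.2.1 p \in S (tag p).
    by rewrite zP; apply/existsP; exists p; rewrite !eqxx.
  by move=> /SB; rewrite inE.
have [/fintype.subsetP SB _] := rX (tag p).
have : z.2.2 p \in rep S (tag p).
  by rewrite zP; apply/existsP; exists p; rewrite !eqxx.
by move=> /SB; rewrite inE.
Qed.

(** * Events of random sets *)

Local Open Scope classical_set_scope.
Local Open Scope ring_scope.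

(** A tuple of finite sets takes countably many values, and each of them is
    characterised by countably many membership events. *)
Lemma measurable_fset_event (d : measure_display) (T : measurableType d)
    (s : nat) (A : 'I_s -> T -> {fset nat}) (Q : ('I_s -> {fset nat}) -> Prop) :
  (forall i m, measurable [set w | m \in A i w]) ->
  measurable [set w | Q (fun i => A i w)].
Proof.
move=> mA.
have mA1 i (B : {fset nat}) : measurable [set w | A i w = B].
  rewrite (_ : [set _ | _] = \bigcap_m [set w | (m \in A i w) = (m \in B)]).
    apply: bigcapT_measurable => m; case: (m \in B); first exact: mA.
    rewrite (_ : [set _ | _] = ~` [set w | m \in A i w]).
      exact: measurableC.
    by apply/seteqP; split=> w /= mAw; [rewrite mAw|apply/negP].
  apply/seteqP; split=> w /= => [AB m _ /=|AB]; first by rewrite AB.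
  by apply/fsetP => m; exact: AB.
have mAB (B : {ffun 'I_s -> {fset nat}}) : measurable [set w | forall i, A i w = B i].
  rewrite (_ : [set _ | _] = \bigcap_(i in [set: 'I_s]) [set w | A i w = B i]).
    apply: fin_bigcap_measurable => //; exact: finite_finset.
  by apply/seteqP; split=> w /= AB i; [move=> _; exact: AB|exact: AB].
pose F (B : {ffun 'I_s -> {fset nat}}) : set T :=
  if asbool (Q B) then [set w | forall i, A i w = B i] else set0.
rewrite (_ : [set _ | _] = \bigcup_B F B).
  apply: countable_bigcupT_measurable => [|B]; first exact: countableP.
  by rewrite /F; case: asboolP.
apply/seteqP; split=> w /= => [QA|[B _]].
  exists [ffun i => A i w] => //; rewrite /F; case: asboolP => [_ i|].
    by rewrite /= ffunE.
  case; suff <- : (fun i => A i w) = [ffun i => A i w] :> ('I_s -> _) by [].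
  by apply/funext => i; rewrite ffunE.
rewrite /F; case: asboolP => // QB /= AB.
by rewrite (_ : (fun i => A i w) = B)//; apply/funext => i; rewrite AB.
Qed.

(** Markov's inequality for a nonnegative combination of indicators.  The weights
    may be negative, so that it also applies to an expanded square. *)
Lemma markov_events (R : realType) (d : measure_display) (T : measurableType d)
    (P : probability T R) (J : finType) (E : J -> set T) (b : J -> R)
    (D : set T) (c : R) :
  measurable D -> (forall j, measurable (E j)) -> 0 <= c ->
  (forall w, 0 <= \sum_j b j * \1_(E j) w) ->
  (forall w, D w -> c <= \sum_j b j * \1_(E j) w) ->
  (c%:E * P D <= \sum_j (b j)%:E * P (E j))%E.
Proof.
move=> mD mE c_ge0 sum_ge0 D_sum.
have intE j : P.-integrable setT (fun w => (b j * \1_(E j) w)%:E).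
  under eq_fun do rewrite EFinM.
  apply: integrableZl => //; exact: integrable_indic.
have -> : (\sum_j (b j)%:E * P (E j) =
           \int[P]_w (\sum_j b j * \1_(E j) w)%:E)%E.
  under [RHS]eq_integral do rewrite -sumEFin.
  rewrite integral_sum//; apply: eq_bigr => j _.
  under eq_integral do rewrite EFinM.
  rewrite integralZl//; last exact: integrable_indic.
  by rewrite integral_indic// setIT.
have -> : (c%:E * P D = \int[P]_w (c * \1_D w)%:E)%E.
  under eq_integral do rewrite EFinM.
  rewrite integralZl//; last exact: integrable_indic.
  by rewrite integral_indic// setIT.
apply: ge0_le_integral => //.
- by move=> w _; rewrite lee_fin mulr_ge0.
- apply/measurable_EFinP; apply: measurable_funM => //; exact: measurable_indic.
- apply/measurable_EFinP; apply: measurable_sum => j.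
  apply: measurable_funM => //; exact: measurable_indic.
- move=> w _; rewrite lee_fin indicE; case: (boolP (w \in D)) => [|_].
    by rewrite inE mulr1; exact: D_sum.
  by rewrite mulr0; exact: sum_ge0.
Qed.

Section RandomSet.
Context {R : realType} {d : measure_display} {T : measurableType d}.
Variable P : probability T R.

Lemma prob_fsubset (n : nat) (alpha : R) (A : T -> {fset nat}) (F : {fset nat}) :
  binomial_random_set P n alpha A ->
  (forall m, m \in F -> (1 <= m <= n)%N) ->
  P [set w | (F `<=` A w)%fset] = (alpha ^+ #|` F|)%:E.
Proof.
move=> [_ _ PA indepA] Fn.
rewrite (_ : [set _ | _] = \bigcap_(m in [set` F]) [set w | m \in A w]).
  rewrite indepA; last by move=> m /= /Fn.
  rewrite (eq_big_seq (fun=> alpha%:E)) => [|m mF]; last by rewrite PA// Fn.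
  by rewrite prodEFin big_const_seq count_predT iter_mulr_1.
apply/seteqP; split=> w /= FA; first by move=> m mF; exact: (fsubsetP FA).
by apply/fsubsetP => m mF; exact: FA.
Qed.

Lemma prob_fsubset_family (s : nat) (n : 'I_s -> nat) (alpha : 'I_s -> R)
    (A : 'I_s -> T -> {fset nat}) (F : 'I_s -> {fset nat}) :
  (forall i, binomial_random_set P (n i) (alpha i) (A i)) ->
  independent_random_sets P A ->
  (forall i m, m \in F i -> (1 <= m <= n i)%N) ->
  P [set w | forall i, (F i `<=` A i w)%fset] = (\prod_i alpha i ^+ #|` F i|)%:E.
Proof.
move=> A_model A_indep Fn.
rewrite (_ : [set _ | _] =
    \bigcap_(i in [set: 'I_s]) (A i @^-1` [set B | (F i `<=` B)%fset])); last first.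
  by apply/seteqP; split=> w /= FA i; [move=> _; exact: FA|exact: FA].
rewrite A_indep -prodEFin; apply: eq_bigr => i _.
by rewrite -(prob_fsubset (A_model i) (Fn i)).
Qed.

(** Chebyshev's inequality: on the event, [(|A| - a) ^ 2 >= a ^ 2 / 4] with
    [a = alpha n], while the expectation of the square is at most [a]. *)
Lemma prob_lower_tail (n : nat) (alpha : R) (A : T -> {fset nat}) :
  0 <= alpha -> 0 < alpha * n%:R -> binomial_random_set P n alpha A ->
  (P [set w | (#|` A w|%:R < alpha * n%:R / 2)%R] <= (4 / (alpha * n%:R))%:E)%E.
Proof.
move=> alpha_ge0 a_gt0 A_model; have [A_le mA _ _] := A_model.
set a := alpha * n%:R in a_gt0 *.
pose E (i : 'I_n) := [set w | i.+1 \in A w].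
have mE i : measurable (E i) by exact: mA.
have PE i : P (E i) = alpha%:E.
  rewrite -[alpha]expr1 -(cardfs1 i.+1) -(prob_fsubset A_model) => [|m].
    by congr (P _); apply/seteqP; split=> w /=; rewrite /E /= fsub1set.
  by rewrite inE => /eqP ->; rewrite /= ltn_ord.
have PEE i j : (P (E i `&` E j) <= (alpha ^+ 2 + (i == j)%:R * alpha)%:E)%E.
  have [->|ij] := eqVneq i j.
    by rewrite setIid PE lee_fin mul1r lerDr exprn_ge0.
  rewrite mul0r addr0 (_ : 2%N = #|` [fset i.+1; j.+1]%fset|); last first.
    by rewrite cardfs2 eqSS ij.
  rewrite -(prob_fsubset A_model) => [|m].
    rewrite le_eqVlt; apply/orP; left; apply/eqP; congr (P _).
    by apply/seteqP; split=> w /=; rewrite /E /= fsubUset !fsub1set => /andP.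
  by rewrite !inE => /orP[] /eqP ->; rewrite /= ltn_ord.
have cardA w : #|` A w|%:R = \sum_i \1_(E i) w :> R.
  rewrite -(@card_ord_mem n) => [|m /A_le /andP[]//].
  rewrite -sum1_card big_mkcond natr_sum big_ord_recl /= inE.
  rewrite (_ : (0 \in A w)%N = false) ?add0r; last first.
    by apply/negbTE/negP => /A_le.
  apply: eq_bigr => i _; rewrite !inE indicE /E /=.
  have -> : (w \in [set w | i.+1 \in A w]) = (i.+1 \in A w).
    by apply/idP/idP; rewrite inE.
  by case: (i.+1 \in A w).
(* The expansion of [(|A| - a) ^ 2] as a combination of indicators, of the events
   [E i /\ E j], of the [E i], and of the whole space. *)
pose EJ (j : ('I_n * 'I_n) + ('I_n + unit)) : set T :=
  match j with inl u => E u.1 `&` E u.2 | inr (inl i) => E i | inr (inr _) => setT end.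
pose b (j : ('I_n * 'I_n) + ('I_n + unit)) : R :=
  match j with inl _ => 1 | inr (inl i) => - (2 * a) | inr (inr _) => a ^+ 2 end.
have sumE w : \sum_j b j * \1_(EJ j) w = (#|` A w|%:R - a) ^+ 2.
  rewrite !big_sumType /= (big_pred1 tt) => [|[]//].
  rewrite -!mulr_sumr mul1r -cardA indicT mulr1.
  rewrite (_ : \sum_(i | _) _ = #|` A w|%:R ^+ 2); first by ring.
  rewrite expr2 cardA big_distrlr /= pair_big; apply: eq_bigr => u _.
  by rewrite indicI.
have mD : measurable [set w | (#|` A w|%:R < a / 2)%R].
  pose A' (i : 'I_1) := A.
  exact: (@measurable_fset_event _ _ _ A' (fun B => #|` B ord0|%:R < a / 2)).
have := @markov_events R d T P _ EJ b _ (a ^+ 2 / 4) mD.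
have -> : (P [set w | (#|` A w|%:R < a / 2)%R] <= (4 / a)%:E)%E =
          ((a ^+ 2 / 4)%:E * P [set w | (#|` A w|%:R < a / 2)%R] <= a%:E)%E.
  rewrite -[P _]fineK ?fin_num_measure// -EFinM !lee_fin.
  rewrite ler_pdivlMr// -[RHS](ler_pM2l (x := a^-1 * 4)); last first.
    by rewrite mulr_gt0// invr_gt0.
  by congr (_ <= _); field; rewrite gt_eqF.
move=> /(_ _ _ _ _)/le_trans; apply.
- by move=> [[i j]|[i|[]]]; rewrite /EJ//; exact: measurableI.
- by rewrite divr_ge0 ?exprn_ge0// ltW.
- by move=> w; rewrite sumE sqr_ge0.
- by move=> w /= Aw; rewrite sumE; nra.
rewrite !big_sumType /= (big_pred1 tt) => [|[]//].
rewrite probability_setT mule1.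
have sumPE : (\sum_i (- (2 * a))%:E * P (E i) = (- (2 * a) * a)%:E)%E.
  rewrite (eq_bigr (fun=> (- (2 * a) * alpha)%:E)) => [|i _]; last by rewrite PE.
  by rewrite sumEFin sumr_const card_ord -[X in X%:E]mulr_natr /a; congr EFin; ring.
rewrite sumPE.
have sumPEE : (\sum_(u : 'I_n * 'I_n) 1%:E * P (E u.1 `&` E u.2) <= (a ^+ 2 + a)%:E)%E.
  apply: (@le_trans _ _ (\sum_(u : 'I_n * 'I_n)
      (alpha ^+ 2 + (u.1 == u.2)%:R * alpha)%:E)%E).
    by apply: lee_sum => u _; rewrite mul1e.
  rewrite sumEFin lee_fin.
  rewrite -(pair_bigA _ (fun i j => alpha ^+ 2 + (i == j)%:R * alpha)) /=.
  rewrite (eq_bigr (fun=> n%:R * alpha ^+ 2 + alpha)) => [|i _].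
    rewrite sumr_const card_ord -[X in X <= _]mulr_natl /a.
    by rewrite le_eqVlt; apply/orP; left; apply/eqP; ring.
  rewrite big_split /= sumr_const card_ord -[alpha ^+ 2 *+ n]mulr_natl -mulr_suml.
  rewrite (bigD1 i)//= eqxx big1 ?addr0 ?mul1r// => j ji.
  by rewrite eq_sym (negbTE ji).
apply: (le_trans (leeD sumPEE (lexx ((- (2 * a) * a)%:E + (a ^+ 2)%:E)%E))).
rewrite -!EFinD lee_fin.
by rewrite le_eqVlt; apply/orP; left; apply/eqP; ring.
Qed.

(** Separation says that the [i]-th set has to contain as many distinct elements
    as there are positions in the [i]-th block, plus those of them in [T]. *)
Lemma prob_captured (s : nat) (k n : 'I_s -> nat) (M : nat) (alpha : 'I_s -> R)
    (A : 'I_s -> T -> {fset nat}) z :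
  (forall i, 0 <= alpha i <= 1) ->
  (forall i, binomial_random_set P (n i) (alpha i) (A i)) ->
  independent_random_sets P A ->
  z \in bad_collisions k n M ->
  P [set w | captured (fun i => A i w) z] =
    (\prod_(p : position k) alpha (tag p) * \prod_(p in z.1) alpha (tag p))%:E.
Proof.
move=> alpha01 A_model A_indep; rewrite inE => /and3P[_ zcol].
move=> /and3P[/forallP x_inj /forallP y_inj /forallP yx].
case: z => [Tz [x y]] /= in zcol x_inj y_inj yx *.
move: zcol; rewrite inE /= => /and3P[/forallP xy_le /forallP xyN _].
pose I1 i : {set position k} := [set p : position k | tag p == i]%SET.
pose I2 i : {set position k} := [set p : position k | (p \in Tz) && (tag p == i)]%SET.
pose Fx i : {set 'I_M.+1} := (x @: I1 i)%SET.
pose Fy i : {set 'I_M.+1} := (y @: I2 i)%SET.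
pose F i : {fset nat} := [fset (val v) | v in Fx i :|: Fy i]%fset.
have cardF i : #|` F i| = (#|I1 i| + #|I2 i|)%N.
  rewrite card_imfset /=; last exact: val_inj.
  rewrite -cardE cardsU disjoint_setI0 ?cards0 ?subn0; last first.
    rewrite -setI_eq0; apply/eqP/setP => v; rewrite !inE; apply/negbTE/negP.
    move=> /andP[/imsetP[q] + ->] /imsetP[p].
    rewrite !inE => /eqP qi /andP[pT /eqP pi] /esym yxpq.
    have /forallP/(_ q)/implyP/(_ pT)/implyP := yx p.
    by rewrite pi qi eqxx yxpq eqxx => /(_ isT).
  rewrite !card_in_imset// => p q; rewrite !inE.
    move=> /andP[_ /eqP pi] /andP[_ /eqP qi] pq; apply/eqP.
    have /forallP/(_ q) := y_inj p.
    by rewrite pi qi pq !eqxx.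
  move=> /eqP pi /eqP qi pq; apply/eqP.
  have /forallP/(_ q) := x_inj p.
  by rewrite pi qi pq !eqxx.
transitivity (P [set w | forall i, (F i `<=` A i w)%fset]).
  congr (P _); apply/seteqP; split=> w /=.
    move=> /forallP zA i; apply/fsubsetP => m /imfsetP[v /= + ->].
    rewrite inE => /orP[] /imsetP[p]; rewrite inE.
      by move=> /eqP <- ->; case/andP: (zA p).
    by move=> /andP[_ /eqP <-] ->; case/andP: (zA p).
  move=> FA; apply/forallP => p; have /fsubsetP FAp := FA (tag p).
  have xF : val (x p) \in F (tag p).
    apply/imfsetP; exists (x p) => //=; rewrite inE; apply/orP; left.
    by apply/imsetP; exists p; rewrite ?inE.
  rewrite /= FAp//=; have [pT|pT] := boolP (p \in Tz); last first.
    by have /implyP/(_ pT)/eqP <- := xyN p; rewrite FAp.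
  apply/FAp/imfsetP; exists (y p) => //=; rewrite inE; apply/orP; right.
  by apply/imsetP; exists p; rewrite ?inE ?pT ?eqxx.
rewrite (prob_fsubset_family A_model A_indep) => [|i m /imfsetP[v /= + ->]].
  congr (_%:E).
  rewrite (partition_big (fun p : position k => tag p) xpredT)//=.
  rewrite [X in _ * X](partition_big (fun p : position k => tag p) xpredT)//=.
  rewrite -big_split /=; apply: eq_bigr => i _.
  rewrite cardF exprD; congr (_ * _).
    rewrite (eq_bigr (fun=> alpha i)) => [|p /eqP -> //].
    by rewrite -prodr_const; apply: eq_bigl => p; rewrite inE.
  rewrite (eq_bigr (fun=> alpha i)) => [|p /andP[_ /eqP -> //]].
  by rewrite -prodr_const; apply: eq_bigl => p; rewrite inE.
rewrite inE => /orP[] /imsetP[p]; rewrite inE.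
  by move=> /eqP <- ->; case/andP: (xy_le p).
by move=> /andP[_ /eqP <-] ->; case/andP: (xy_le p).
Qed.

End RandomSet.

(** * Weighted count and relative error *)

(** The union over [T] of the weighted counts of collisions: since [T] is nonempty
    and every [alpha i * nu] is at most [eta <= 1], each of the at most [2 ^ K]
    sets [T] contributes at most [2 * eta] times the product of the means. *)
Lemma sum_bad_collisions (R : realFieldType) (s : nat) (k n : 'I_s -> nat)
    (M : nat) (alpha : 'I_s -> R) (o : position k) (nu eta : R) :
  (forall i, (n i <= M)%N) -> (forall i, 0 <= alpha i) -> 0 <= nu ->
  ((2 < #|{: position k}|)%N ->
    \prod_(q | q != o) series harmonic (n (tag q)) <= nu) ->
  (#|{: position k}| = 2%N ->
    \prod_(q | q != o) series harmonic (n (tag q)) <= nu ^+ 2) ->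
  (forall i, alpha i * nu <= eta) -> eta <= 1 ->
  \sum_(z in bad_collisions k n M)
      (\prod_(p : position k) alpha (tag p) * \prod_(p in z.1) alpha (tag p))
    <= 2 ^+ #|{: position k}|.+1 * eta *
       \prod_(p : position k) (alpha (tag p) * (n (tag p))%:R).
Proof.
move=> nM alpha_ge0 nu_ge0 nu3 nu2 nu_eta eta_le1.
pose N := \prod_(p : position k) ((n (tag p))%:R : R).
pose Al := \prod_(p : position k) alpha (tag p).
pose n' (p : position k) := n (tag p).
have eta_ge0 : 0 <= eta.
  by apply: le_trans (nu_eta (tag o)); rewrite mulr_ge0.
have prodA_ge0 (T : {set position k}) : 0 <= \prod_(p in T) alpha (tag p).
  by rewrite prodr_ge0.
have Al_ge0 : 0 <= Al by rewrite prodr_ge0.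
have N_ge0 : 0 <= N by apply: prodr_ge0 => p _; rewrite ler0n.
apply: (@le_trans _ _ (\sum_(T : {set position k} | (1 < #|T|)%N)
    \sum_(xy in collisions n' M T) (Al * \prod_(p in T) alpha (tag p)))).
  rewrite pair_big_dep /= big_mkcond [X in _ <= X]big_mkcond /=.
  apply: ler_sum => -[T xy] _; rewrite inE /=.
  case: (_ < _)%N => //=; case: (xy \in _) => //=.
  by case: ifP => // _; rewrite mulr_ge0.
apply: (@le_trans _ _ (\sum_(T : {set position k} | (1 < #|T|)%N)
    (2 * (Al * N) * eta))).
  apply: ler_sum => T T2; rewrite sumr_const -[X in X <= _]mulr_natr.
  have colT := @card_collisions_weighted _ n' M (fun p => nM (tag p)) R o T nu nu3 nu2 T2.
  apply: (@le_trans _ _ (Al * \prod_(p in T) alpha (tag p) *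
      (2 * N * \prod_(p in T) nu))).
    by rewrite ler_wpM2l// mulr_ge0.
  rewrite [X in X <= _](_ : _ = 2 * (Al * N) *
      \prod_(p in T) (alpha (tag p) * nu)); last by rewrite big_split /=; ring.
  rewrite ler_wpM2l ?mulr_ge0 ?ler0n//.
  have [p pT] : exists p, p \in T by apply/card_gt0P; exact: ltnW.
  rewrite (bigD1 p)//= -[X in _ <= X]mulr1 ler_pM ?mulr_ge0 ?prodr_ge0//.
    by move=> q _; rewrite mulr_ge0.
  rewrite prodr_ile1// => q _; rewrite mulr_ge0//=.
  exact: le_trans (nu_eta _) eta_le1.
rewrite sumr_const -[X in X <= _]mulr_natr big_split /= -/Al -/N.
have card_le : (#|[pred T : {set position k} | (1 < #|T|)%N]|%:R : R)
    <= 2 ^+ #|{: position k}|.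
  rewrite -natrX ler_nat (leq_trans (max_card _))//.
  by rewrite -cardsT -powersetT card_powerset cardsT.
apply: le_trans (ler_wpM2l _ card_le) _; first by rewrite !mulr_ge0 ?ler0n.
by rewrite exprS le_eqVlt; apply/orP; left; apply/eqP; ring.
Qed.

Lemma bin_le_expr (R : realFieldType) (m k : nat) (t : R) : k%:R <= t * m%:R ->
  'C((m + k).-1, k)%:R <= m%:R ^+ k / k`!%:R * (1 + t) ^+ k.
Proof.
move=> kt; rewrite mulrAC ler_pdivlMr ?ltr0n ?fact_gt0//.
rewrite -natrM bin_ffact -exprMn.
apply: (@le_trans _ _ ((m + k)%N%:R ^+ k)).
  rewrite -natrX ler_nat ffact_prod.
  rewrite -[X in (_ <= _ ^ X)%N]card_ord -prod_nat_const.
  by apply: leq_prod => i _; lia.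
have mk_le : (m + k)%N%:R <= m%:R * (1 + t) :> R by rewrite natrD; lra.
by rewrite lerXn2r// nnegrE ?ler0n// (le_trans _ mk_le).
Qed.

Lemma expr_le_bin (R : realFieldType) (m k : nat) (t : R) :
  t <= 1 -> k%:R <= t * m%:R ->
  m%:R ^+ k / k`!%:R * (1 - t) ^+ k <= 'C(m, k)%:R.
Proof.
move=> t1 kt; rewrite mulrAC ler_pdivrMr ?ltr0n ?fact_gt0//.
rewrite -natrM bin_ffact -exprMn.
have m_ge0 := ler0n R m.
apply: (@le_trans _ _ ((m - k)%N%:R ^+ k)).
  have km : (k <= m)%N by rewrite -(ler_nat R); nra.
  apply: lerXn2r; rewrite ?nnegrE ?ler0n//; first by rewrite mulr_ge0// subr_ge0.
  by rewrite natrB//; nra.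
rewrite -natrX ler_nat ffact_prod.
rewrite -[X in (_ ^ X <= _)%N]card_ord -prod_nat_const.
by apply: leq_prod => i _; have := ltn_ord i; lia.
Qed.

Lemma bernoulli_ineq (R : realFieldType) (t : R) (K : nat) :
  0 <= t <= 1 -> 1 - K%:R * t <= (1 - t) ^+ K.
Proof.
move=> /andP[t0 t1]; elim: K => [|K IHK]; first by rewrite mul0r subr0 expr0.
rewrite exprS -natr1; have := ler_wpM2l (_ : 0 <= 1 - t) IHK.
rewrite subr_ge0 => /(_ t1); apply: le_trans.
have := ler0n R K; nra.
Qed.

(** The deterministic part: with [t] a bound for the [k i / m i], the two products
    of binomials lie between [(1 - t) ^ K * Y] and [(1 + t) ^ K * Y], that is,
    within [2 K t Y] of [Y]. *)
Lemma relative_error (R : realFieldType) (s : nat) (k m : 'I_s -> nat)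
    (X Z : nat) (eps t : R) :
  let K := (\sum_i k i)%N in
  let Y : R := \prod_i ((m i)%:R ^+ k i / (k i)`!%:R) in
  0 < eps -> 0 <= t <= 1 -> K%:R * t <= 1 / 2 -> K%:R * t <= eps / 4 ->
  (forall i, 0 < m i)%N -> (forall i, (k i)%:R <= t * (m i)%:R) ->
  (X <= \prod_i 'C((m i + k i).-1, k i))%N ->
  (\prod_i 'C(m i, k i) <= X + Z)%N ->
  Z%:R < eps / 2 * Y -> `|X%:R - Y| < eps * `|Y|.
Proof.
move=> K Y eps_gt0 /[dup] t01 /andP[t0 t1] Kt2 Kt4 m_gt0 kt XY YXZ ZY.
have Y_gt0 : 0 < Y.
  apply: prodr_gt0 => i _; rewrite divr_gt0 ?exprn_gt0 ?ltr0n//.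
  exact: fact_gt0.
rewrite (gtr0_norm Y_gt0).
have upper : X%:R <= Y * (1 + t) ^+ K.
  apply: (@le_trans _ _ (\prod_i 'C((m i + k i).-1, k i))%:R).
    by rewrite ler_nat.
  rewrite natr_prod -prodrXr -big_split /=; apply: ler_prod => i _.
  by rewrite ler0n bin_le_expr.
have lower : Y * (1 - t) ^+ K <= X%:R + Z%:R.
  apply: (@le_trans _ _ (\prod_i 'C(m i, k i))%:R); last by rewrite -natrD ler_nat.
  rewrite natr_prod -prodrXr -big_split /=; apply: ler_prod => i _.
  rewrite expr_le_bin// andbT; apply: mulr_ge0.
    by rewrite divr_ge0 ?exprn_ge0 ?ler0n.
  by rewrite exprn_ge0 ?subr_ge0.
have low := bernoulli_ineq K t01.
(* With the lower bound for [(1 - t) ^ K], this bounds [(1 + t) ^ K] above. *)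
have prod_le1 : (1 + t) ^+ K * (1 - t) ^+ K <= 1.
  rewrite -exprMn exprn_ile1//; nra.
have up : (1 + t) ^+ K <= 1 + 2 * (K%:R * t).
  have : 1 <= (1 + t) ^+ K by rewrite exprn_ege1// lerDl.
  have : 0 <= K%:R * t by rewrite mulr_ge0 ?ler0n.
  nra.
rewrite ltr_norml; apply/andP; split; nra.
Qed.

(** * The probability of a large relative error *)

Lemma prod_position_tag (R : comRingType) (s : nat) (k : 'I_s -> nat)
    (a : 'I_s -> R) :
  \prod_(p : position k) a (tag p) = \prod_i a i ^+ k i.
Proof.
rewrite -(sig_big_dep xpredT (fun _ => xpredT) (fun i (_ : 'I_(k i)) => a i)) /=.
by apply: eq_bigr => i _; rewrite prodr_const card_ord.
Qed.

Section FixedParameters.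
Context {R : realType} {d : measure_display} {T : measurableType d}.
Variable P : probability T R.

Lemma union_bound (J : finType) (E : J -> set T) (D : set T) :
  measurable D -> (forall j, measurable (E j)) ->
  (forall w, D w -> exists j, E j w) -> (P D <= \sum_j P (E j))%E.
Proof.
move=> mD mE D_E; rewrite -[P D]mul1e.
under eq_bigr do rewrite -[P (E _)]mul1e.
have ge0 j w : 0 <= 1 * \1_(E j) w :> R by rewrite mul1r indicE ler0n.
apply: (@markov_events R d T P J E (fun=> 1)) => // w; first exact: sumr_ge0.
move=> /D_E[j Ejw]; rewrite (bigD1 j)//= mul1r {1}indicE mem_set//.
by rewrite lerDl sumr_ge0.
Qed.

Variables (s : nat) (k n : 'I_s -> nat) (alpha : 'I_s -> R).
Variable A : 'I_s -> T -> {fset nat}.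
Hypothesis alpha01 : forall i, 0 <= alpha i <= 1.
Hypothesis A_model : forall i, binomial_random_set P (n i) (alpha i) (A i).
Hypothesis A_indep : independent_random_sets P A.

Let a i := alpha i * (n i)%:R.
Let K := (\sum_i k i)%N.
Hypothesis a_gt0 : forall i, 0 < a i.

Let measurable_A (Q : ('I_s -> {fset nat}) -> Prop) :
  measurable [set w | Q (fun i => A i w)].
Proof. by apply: measurable_fset_event => i m; have [] := A_model i. Qed.

Lemma prob_many_bad_collisions (M : nat) (o : position k) (nu eta c : R) :
  (forall i, (n i <= M)%N) -> 0 <= nu ->
  ((2 < K)%N -> \prod_(q | q != o) series harmonic (n (tag q)) <= nu) ->
  (K = 2%N -> \prod_(q | q != o) series harmonic (n (tag q)) <= nu ^+ 2) ->
  (forall i, alpha i * nu <= eta) -> eta <= 1 -> 0 <= c ->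
  (c%:E * P [set w | (c <= (bad_count k n M (fun i => A i w))%:R)%R]
   <= (2 ^+ K.+1 * eta * \prod_i a i ^+ k i)%:E)%E.
Proof.
move=> nM nu_ge0 nu3 nu2 nu_eta eta_le1 c_ge0.
have cardK : #|{: position k}| = K := tagnat.card.
have alpha_ge0 i : 0 <= alpha i by case/andP: (alpha01 i).
pose V := {ffun position k -> 'I_M.+1}.
pose E (z : {set position k} * (V * V)) := [set w | captured (fun i => A i w) z].
pose b (z : {set position k} * (V * V)) : R := (z \in bad_collisions k n M)%:R.
have sumE w : \sum_z b z * \1_(E z) w = (bad_count k n M (fun i => A i w))%:R.
  rewrite /bad_count -sum1_card natr_sum [RHS]big_mkcond /=; apply: eq_bigr => z _.
  rewrite /b indicE -natrM mulnb [X in if X then _ else _]inE.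
  have -> : (w \in E z) = captured (fun i => A i w) z.
    by apply/idP/idP; rewrite inE.
  by case: (_ && _).
apply: (@le_trans _ _ (\sum_z (b z)%:E * P (E z))%E).
  apply: markov_events => //.
  - exact: (@measurable_A (fun B => c <= (bad_count k n M B)%:R)).
  - by move=> z; exact: (@measurable_A (fun B => captured B z)).
  - by move=> w; rewrite sumE ler0n.
  - by move=> w /=; rewrite sumE.
rewrite (eq_bigr (fun z => (b z * (\prod_(p : position k) alpha (tag p) *
      \prod_(p in z.1) alpha (tag p)))%:E)); last first.
  move=> z _; rewrite EFinM /b; case: (boolP (z \in _)) => zbad.
    by rewrite (prob_captured alpha01 A_model A_indep zbad).
  by rewrite !mul0e.
rewrite sumEFin lee_fin -(@prod_position_tag _ _ k) -cardK.
rewrite -cardK in nu3 nu2.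
apply: le_trans (sum_bad_collisions nM alpha_ge0 nu_ge0 nu3 nu2 nu_eta eta_le1).
by rewrite [X in _ <= X]big_mkcond /=; apply: ler_sum => z _; rewrite /b;
  case: (z \in _); rewrite ?mul1r ?mul0r.
Qed.

(** The error is small unless some [|A i|] is below half its mean or the number
    of captured collisions exceeds [eps / 2] times the value of [Y] at these half
    means. *)
Lemma prob_relative_error (o : position k) (nu eta eps t : R) :
  0 <= nu ->
  ((2 < K)%N -> \prod_(q | q != o) series harmonic (n (tag q)) <= nu) ->
  (K = 2%N -> \prod_(q | q != o) series harmonic (n (tag q)) <= nu ^+ 2) ->
  (forall i, alpha i * nu <= eta) -> eta <= 1 ->
  0 < eps -> 0 <= t <= 1 -> K%:R * t <= 1 / 2 -> K%:R * t <= eps / 4 ->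
  (forall i, (k i)%:R <= t * (a i / 2)) ->
  (P [set w |
      (`|(#|` prodpowset (fun i => A i w) k|)%:R -
         \prod_(i < s) ((#|` A i w|)%:R ^+ k i / (k i)`!%:R)| >=
       eps * `|\prod_(i < s) ((#|` A i w|)%:R ^+ k i / (k i)`!%:R)|)%R]
   <= (\sum_i 4 / a i +
       2 ^+ K.+1 * (2 / eps) * (2 ^+ K * \prod_i (k i)`!%:R) * eta)%:E)%E.
Proof.
move=> nu_ge0 nu3 nu2 nu_eta eta_le1 eps_gt0 t01 Kt2 Kt4 kt.
pose M := \max_i n i.
have nM i : (n i <= M)%N by exact: leq_bigmax.
pose c : R := eps / 2 * \prod_i ((a i / 2) ^+ k i / (k i)`!%:R).
have c_gt0 : 0 < c.
  rewrite mulr_gt0 ?divr_gt0//; apply: prodr_gt0 => i _.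
  by rewrite divr_gt0 ?exprn_gt0 ?divr_gt0 ?ltr0n ?fact_gt0.
pose Z w := (bad_count k n M (fun i => A i w)).
pose E (j : 'I_s + unit) : set T :=
  match j with inl i => [set w | (#|` A i w|%:R < a i / 2)%R]
             | inr _ => [set w | (c <= (Z w)%:R)%R] end.
have -> : (\sum_i 4 / a i +
       2 ^+ K.+1 * (2 / eps) * (2 ^+ K * \prod_i (k i)`!%:R) * eta)%:E =
   (\sum_(j : 'I_s + unit) match j with inl i => (4 / a i)%:E
   | inr _ => (2 ^+ K.+1 * (2 / eps) * (2 ^+ K * \prod_i (k i)`!%:R) * eta)%:E end)%E.
  by rewrite big_sumType /= (big_pred1 tt) => [|[]//]; rewrite sumEFin.
apply: (@le_trans _ _ (\sum_j P (E j))%E).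
  apply: union_bound.
  - exact: (@measurable_A (fun B =>
      eps * `|\prod_(i < s) ((#|` B i|)%:R ^+ k i / (k i)`!%:R)| <=
      `|(#|` prodpowset B k|)%:R - \prod_(i < s) ((#|` B i|)%:R ^+ k i / (k i)`!%:R)|)).
  - move=> [i|[]]; first exact: (@measurable_A (fun B => #|` B i|%:R < a i / 2)).
    exact: (@measurable_A (fun B => c <= (bad_count k n M B)%:R)).
  - move=> w /=; apply: contraPP => /forallNP noE; apply/negP; rewrite -ltNge.
    have A_ge i : a i / 2 <= #|` A i w|%:R.
      by rewrite leNgt; apply/negP; exact: (noE (inl i)).
    have Z_lt : (Z w)%:R < c by rewrite ltNge; apply/negP; exact: (noE (inr tt)).
    have A_in i m : m \in A i w -> (1 <= m <= n i)%N by case: (A_model i) => + _ _ _; exact.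
    apply: (@relative_error _ _ _ _ _ (Z w) _ t) => //.
    + by move=> i; rewrite -(ltr0n R) (lt_le_trans _ (A_ge i))// divr_gt0.
    + move=> i; apply: le_trans (kt i) _; apply: ler_wpM2l => //.
      by case/andP: t01.
    + exact: card_prodpowset.
    + exact: prod_bin_le_card.
    + apply: lt_le_trans Z_lt _; apply: ler_wpM2l.
        by rewrite divr_ge0 ?ltW.
      apply: ler_prod => i _; have a2_ge0 : 0 <= a i / 2 by rewrite divr_ge0 ?ltW.
      rewrite divr_ge0 ?exprn_ge0 ?ler0n//=.
      by rewrite ler_wpM2r ?invr_ge0 ?ler0n// lerXn2r ?nnegrE ?ler0n.
apply: lee_sum => -[i|[]] _ /=.
  by apply: prob_lower_tail; rewrite ?a_gt0//; case/andP: (alpha01 i).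
have := prob_many_bad_collisions nM nu_ge0 nu3 nu2 nu_eta eta_le1 (ltW c_gt0).
rewrite -/(Z _) -[P _]fineK ?fin_num_measure//; last first.
  exact: (@measurable_A (fun B => c <= (bad_count k n M B)%:R)).
rewrite -EFinM !lee_fin => cP; rewrite -(ler_pM2l c_gt0); apply: le_trans cP _.
rewrite le_eqVlt; apply/orP; left; apply/eqP.
have -> : \prod_i a i ^+ k i = \prod_i ((a i / 2) ^+ k i / (k i)`!%:R) *
     (2 ^+ K * \prod_i (k i)`!%:R).
  rewrite -prodrXr -!big_split /=; apply: eq_bigr => i _.
  rewrite expr_div_n; field; rewrite expf_neq0//= ?pnatr_eq0//.
  by rewrite -lt0n fact_gt0.
rewrite /c; field; exact: lt0r_neq0.
Qed.

End FixedParameters.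

(** * Passage to the limit *)

Lemma ln4_ge1 (R : realType) : 1 <= ln (4 : R).
Proof.
have ln_half : ln (2^-1 : R) <= - 2^-1.
  rewrite (_ : 2^-1 = 1 + - 2^-1 :> R); last by field.
  by apply: le_trans (le_ln1Dx _) _; lra.
rewrite (_ : 4 = 2 * 2 :> R); last by ring.
rewrite lnM ?posrE//; move: ln_half; rewrite lnV ?posrE//; lra.
Qed.

(** The increments [ln (m + 1) - ln m >= 1 / (m + 1)] give [1 + ln n], and from [4] on
    the constant is absorbed by the logarithm. *)
Lemma series_harmonic_le (R : realType) (n : nat) :
  (4 <= n)%N -> series harmonic n <= 2 * ln (n%:R : R).
Proof.
have le1 m : series harmonic m.+1 <= 1 + ln (m.+1%:R : R).
  elim: m => [|m IHm].
    by rewrite seriesSr /series /= big_geq// add0r invr1 ln1 addr0.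
  have -> : series harmonic m.+2 = series harmonic m.+1 + m.+2%:R^-1 :> R.
    by rewrite seriesSr.
  have m1_gt0 : 0 < m.+1%:R :> R by rewrite ltr0n.
  have m2_gt0 : 0 < m.+2%:R :> R by rewrite ltr0n.
  have : ln (m.+1%:R / m.+2%:R : R) <= - m.+2%:R^-1.
    rewrite (_ : m.+1%:R / m.+2%:R = 1 + - m.+2%:R^-1 :> R).
      by apply: le_ln1Dx; rewrite ltrN2 invf_lt1// ltr1n.
    by rewrite -[m.+1%:R](addrK 1) natr1 mulrBl divff ?gt_eqF// mul1r.
  rewrite ln_div ?posrE//; move: IHm.
  by move: (series _ _) (ln m.+1%:R) (ln m.+2%:R) (m.+2%:R^-1) => u v w x; lra.
case: n => // n n4; apply: le_trans (le1 n) _.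
have : 1 <= ln (n.+1%:R : R).
  by apply: le_trans (ln4_ge1 R) _; rewrite ler_ln ?posrE ?ltr0n// ler_nat.
lra.
Qed.

(** Identifies the product of logarithms in the theorem: omitting one position of
    the first block lowers the exponent of its logarithm by one. *)
Lemma prod_other_positions (R : fieldType) (s : nat) (k : 'I_s -> nat)
    (o : position k) (l : 'I_s -> R) : l (tag o) != 0 ->
  \prod_(q | q != o) l (tag q) =
    l (tag o) ^+ (k (tag o) - 1) * \prod_(j | j != tag o) l j ^+ k j.
Proof.
move=> lo; apply: (mulfI lo); have := prod_position_tag k l.
rewrite (bigD1 o)//= => ->; rewrite (bigD1 (tag o))//= mulrA -exprS.
by rewrite subn1 prednK//; case: (k _) (tagged o) => [[]|].
Qed.

Lemma cvg_prob0 (R : realType) (p : nat -> \bar R) (b : nat -> R) :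
  (forall N, 0 <= p N)%E -> (\forall N \near \oo, (p N <= (b N)%:E)%E) ->
  b N @[N --> \oo] --> 0 -> p N @[N --> \oo] --> 0%E.
Proof.
move=> p_ge0 pb b0.
apply: (@squeeze_cvge _ _ _ _ (cst 0%E) _ (EFin \o b)).
- by near=> N; rewrite /= p_ge0/=; near: N.
- exact: cvg_cst.
- by apply: cvg_EFin => //; near=> N.
Unshelve. all: by end_near. Qed.

Lemma cvg_sum0 (R : realType) (J : finType) (f : nat -> J -> R) :
  (forall j, f N j @[N --> \oo] --> 0) -> \sum_j f N j @[N --> \oo] --> 0.
Proof.
move=> f0; suff : \sum_j f N j @[N --> \oo] --> \sum_(j : J) (0 : R) by rewrite big1.
by apply: cvg_big => //; exact: add_continuous.
Qed.

Theorem theorem1p2 (R : realType) (s : nat) (s_gt0 : (0 < s)%N)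
  (k : 'I_s -> nat) (k_gt0 : forall i, (0 < k i)%N)
  (n : nat -> 'I_s -> nat) (n_gt0 : forall N i, (0 < n N i)%N)
  (alpha : nat -> 'I_s -> R) (alpha01 : forall N i, 0 <= alpha N i <= 1)
  (d : nat -> measure_display) (T : forall N, measurableType (d N))
  (P : forall N, probability (T N) R)
  (A : forall N, 'I_s -> T N -> {fset nat})
  (A_model : forall N i, binomial_random_set (P N) (n N i) (alpha N i) (A N i))
  (A_indep : forall N, independent_random_sets (P N) (A N))
  (alphan_oo : forall i, alpha N i * (n N i)%:R @[N --> \oo] --> +oo)
  (alpha_small : forall i,
    (fun N => alpha N i) =o_\oo
    (fun N =>
      (ln (n N (Ordinal s_gt0))%:R ^+ (k (Ordinal s_gt0) - 1) *
       \prod_(j < s | (0 < j)%N) ln (n N j)%:R ^+ k j)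
      `^ (- (((\sum_(i < s) k i)%:R - 1) / 2)))) :
  whp_equiv P
    (fun N w => (#|` prodpowset (fun i => A N i w) k|)%:R)
    (fun N w => \prod_(i < s) ((#|` A N i w|)%:R ^+ k i / (k i)`!%:R)).
Proof.
pose K := (\sum_i k i)%N.
pose o : position k := Tagged (fun i => 'I_(k i)) (Ordinal (k_gt0 (Ordinal s_gt0))).
pose L N : R := ln (n N (Ordinal s_gt0))%:R ^+ (k (Ordinal s_gt0) - 1) *
       \prod_(j < s | (0 < j)%N) ln (n N j)%:R ^+ k j.
pose mu N := L N `^ ((K%:R - 1) / 2).
(* The power of [2] absorbs the factors [2] in [series harmonic n <= 2 * ln n]. *)
pose nu N := 2 ^+ K * mu N.
pose eta N := \sum_i alpha N i * nu N.
have alpha_ge0 N i : 0 <= alpha N i by case/andP: (alpha01 N i).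
have K_gt0 : (0 < K)%N by rewrite /K (bigD1 (Ordinal s_gt0))//= addn_gt0 k_gt0.
have n_large : \forall N \near \oo, forall i, (4 <= n N i)%N.
  apply: filter_forall => i.
  have /cvgryPge/(_ 4) := alphan_oo i; apply: filterS => N a4.
  rewrite -(ler_nat R); apply: le_trans a4 _.
  by rewrite ler_piMl ?ler0n//; case/andP: (alpha01 N i).
have LE N : (forall i, 4 <= n N i)%N ->
    L N = \prod_(q | q != o) ln (n N (tag q))%:R /\ 1 <= L N.
  move=> n4; have ln_ge1 i : 1 <= ln ((n N i)%:R : R).
    apply: le_trans (ln4_ge1 R) _.
    by rewrite ler_ln ?posrE ?ler_nat// ltr0n (leq_trans _ (n4 i)).
  have LE : L N = \prod_(q | q != o) ln (n N (tag q))%:R.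
    rewrite (@prod_other_positions _ _ _ o (fun i => ln (n N i)%:R)) /=; last first.
      by rewrite gt_eqF// (lt_le_trans _ (ln_ge1 _)).
    congr (_ * _); apply: eq_bigl => j.
    by rewrite lt0n.
  split=> //; rewrite LE; apply: (big_ind (fun x : R => 1 <= x)) => // x y.
  exact: mulr_ege1.
have alpha_nu i : alpha N i * nu N @[N --> \oo] --> 0.
  apply/cvgr0Pnorm_le => e e_gt0.
  have /eqoP/(_ (e / 2 ^+ K)) := alpha_small i.
  rewrite divr_gt0 ?exprn_gt0// => /(_ isT) alpha_le.
  near=> N.
  have [_ L_ge1] : L N = \prod_(q | q != o) ln (n N (tag q))%:R /\ 1 <= L N.
    by apply: LE; near: N.
  have mu_gt0 : 0 < mu N by rewrite powR_gt0// (lt_le_trans _ L_ge1).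
  have : `|alpha N i| <= e / 2 ^+ K * `|(mu N)^-1|.
    by rewrite /mu -powRN; near: N.
  rewrite !ger0_norm ?invr_ge0 ?(ltW mu_gt0)//; last first.
    by rewrite mulr_ge0// mulr_ge0 ?exprn_ge0// ltW.
  rewrite ler_pdivlMr// ler_pdivlMr ?exprn_gt0// /nu.
  by rewrite -mulrA [mu N * _]mulrC.
have eta0 : eta N @[N --> \oo] --> 0 by exact: cvg_sum0.
move=> eps eps_gt0.
(* Any [t > 0] with [K t <= 1 / 2] and [K t <= eps / 4] would do. *)
pose t : R := Num.min (1 / 2) (eps / 4) / K%:R.
have Kt : K%:R * t = Num.min (1 / 2) (eps / 4).
  by rewrite /t mulrC divfK// pnatr_eq0 -lt0n.
have t_gt0 : 0 < t.
  by rewrite divr_gt0 ?ltr0n// lt_min !divr_gt0.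
have Kt2 : K%:R * t <= 1 / 2 by rewrite Kt ge_min lexx.
have Kt4 : K%:R * t <= eps / 4 by rewrite Kt ge_min lexx orbT.
have t01 : 0 <= t <= 1.
  rewrite ltW//=; have : 1 <= K%:R :> R by rewrite ler1n.
  nra.
pose C := 2 ^+ K.+1 * (2 / eps) * (2 ^+ K * \prod_i (k i)`!%:R).
apply: (@cvg_prob0 _ _ (fun N => \sum_i 4 / (alpha N i * (n N i)%:R) + C * eta N)).
- by move=> N; exact: measure_ge0.
- near=> N.
  have n4 : forall i, (4 <= n N i)%N by near: N.
  have [L_prod L_ge1] := LE N n4.
  have a_large i : 2 * (k i)%:R / t <= alpha N i * (n N i)%:R.
    move: i; near: N; apply: filter_forall => i.
    by move/cvgryPge: (alphan_oo i); exact.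
  have mu_ge1 : 1 <= mu N.
    rewrite -(powRr0 (L N)) ler_powR//.
    by rewrite divr_ge0// subr_ge0 ler1n.
  have harm_le : \prod_(q | q != o) series harmonic (n N (tag q)) <= 2 ^+ K * L N.
    rewrite L_prod; apply: (@le_trans _ _ (\prod_(q | q != o) (2 * ln (n N (tag q))%:R))).
      apply: ler_prod => q _; rewrite series_harmonic_le// andbT.
      by apply: sumr_ge0 => j _; exact: harmonic_ge0.
    rewrite big_split /= prodr_const ler_wpM2r//.
      by rewrite -L_prod (le_trans _ L_ge1).
    by rewrite ler_eXn2l ?ltr1n// -[K]tagnat.card max_card.
  apply: (@prob_relative_error _ _ _ _ _ _ _ _ _ _ _ _ _ o (nu N) _ _ t) => //.
  + move=> i; apply: lt_le_trans (a_large i).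
    by rewrite divr_gt0// mulr_gt0// ltr0n.
  + by rewrite mulr_ge0 ?exprn_ge0// (le_trans _ mu_ge1).
  (* Here [L <= mu], because [1 <= L] and the exponent is at least [1]. *)
  + move=> K3; apply: le_trans harm_le _; rewrite ler_wpM2l ?exprn_ge0//.
    rewrite -[X in X <= _]powRr1 ?(le_trans _ L_ge1)// ler_powR//.
    have : 3 <= K%:R :> R by rewrite ler_nat.
    lra.
  (* Here the exponent is [1 / 2], and [mu] is the square root of [L]. *)
  + move=> K2; apply: le_trans harm_le _; rewrite exprMn.
    have -> : mu N ^+ 2 = L N.
      have L_ge0 : 0 <= L N by rewrite (le_trans _ L_ge1).
      rewrite -powR_mulrn ?powR_ge0// -powRrM (K2 : K = 2%N).
      by rewrite (_ : (_ - _) / 2 * _ = 1) ?powRr1//; field.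
    rewrite ler_wpM2r ?(le_trans _ L_ge1)//.
    by rewrite ler_eXnr// exprn_ege1// ler1n.
  + move=> i; rewrite /eta (bigD1 i)//= lerDl sumr_ge0// => j _.
    by rewrite mulr_ge0// mulr_ge0 ?exprn_ge0// (le_trans _ mu_ge1).
  + near: N; have /cvgr0Pnorm_le/(_ 1 ltr01) := eta0.
    by apply: filterS => N; apply: le_trans; exact: ler_norm.
  + move=> i; have := a_large i; rewrite ler_pdivrMr//; lra.
- rewrite -[X in _ --> X]addr0; apply: cvgD; last first.
    by rewrite -[X in _ --> X](mulr0 C); apply: cvgMl_tmp.
  apply: cvg_sum0 => i; rewrite -[X in _ --> X](mulr0 4); apply: cvgMl_tmp.
  apply/gtr0_cvgV0 => //.
  by have /cvgryPgt/(_ 0) := alphan_oo i.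
Unshelve. all: by end_near. Qed.
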